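(* Let $\mathcal{G}=(\mathcal{V},\mathcal{E},A)$ be a weighted digraph on $n$ nodes with adjacency matrix $A=[a_{ij}]$, let $\Delta>0$, and let $q^s(z)=\left\lfloor \frac{z}{\Delta}+\frac12\right\rfloor\Delta$ for $z\in\mathbb{R}$. Consider the system $$\dot x_i=\sum_{j=1}^n a_{ij}\,q^s(x_j-x_i),\qquad i=1,\dots,n.$$ Suppose that either 1) $\mathcal{G}$ is undirected; or 2) $\mathcal{G}$ is a directed ring, or a directed spanning tree. Then every Filippov solution $x:[0,\infty)\to\mathbb{R}^n$ of this system converges asymptotically (as $t\to\infty$, in the sense that its distance to the set tends to $0$) to the set $$\mathcal{H}_1=\left\{x\in\mathbb{R}^n\mid -\tfrac12\Delta\le x_i-x_j\le\tfrac12\Delta\ \text{for all } (v_i,v_j)\in\mathcal{E}\right\}.$$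
   Context: Weighted digraph: node set $\mathcal{V}=\{v_1,\dots,v_n\}$, edge set $\mathcal{E}\subseteq\mathcal{V}\times\mathcal{V}$, adjacency matrix $A=[a_{ij}]$ with $a_{ij}\ge 0$, $a_{ii}=0$, and $a_{ij}>0$ if and only if $(v_j,v_i)\in\mathcal{E}$. The graph is undirected if $A=A^\top$. It is a directed ring if every node has exactly one outgoing edge and exactly one incoming edge. It is a directed spanning tree if there is a root node with no incoming edge, every other node has exactly one incoming edge, and there is a directed path from the root to every other node. For a map $X:\mathbb{R}^n\to\mathbb{R}^n$ the Filippov set-valued map is $\mathcal{F}[X](x)=\bigcap_{\delta>0}\bigcap_{\mu(S)=0}\overline{\mathrm{co}}\{X(B(x,\delta)\setminus S)\}$, where $B(x,\delta)$ is the open ball, $\mu$ is Lebesgue measure and $\overline{\mathrm{co}}$ is the closed convex hull. A Filippov solution of $\dot x=X(x)$ is a (locally) absolutely continuous function $x(t)$ with $\dot x(t)\in\mathcal{F}[X](x(t))$ for almost every $t$. *)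

(* Defs.v *)
From HB Require Import structures.
From mathcomp Require Import all_boot all_order all_algebra.
From mathcomp Require Import all_classical all_reals all_analysis.
Import Order.TTheory GRing.Theory Num.Theory.
Import numFieldNormedType.Exports.
Set Implicit Arguments.
Unset Strict Implicit.
Unset Printing Implicit Defensive.
Local Open Scope classical_set_scope.
Local Open Scope ring_scope.

(* Points of R^n are row vectors. The library gives 'rV[R]_n the usual        *)
(* topology, but through the sup norm; metric notions below use the Euclidean *)
(* norm instead.                                                              *)

Section Euclidean.
Context {R : realType} {n : nat}.
Implicit Types (x : 'rV[R]_n) (A S : set 'rV[R]_n).

Definition enorm x : R := Num.sqrt (\sum_(i < n) x 0 i ^+ 2).

Definition eball x (r : R) : set 'rV[R]_n := [set y | enorm (y - x) < r].

(* [inf set0 = 0], so this is the distance only for nonempty [A]. *)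
Definition dist_to x A : R := inf [set enorm (x - y) | y in A].

Definition closed_convex_hull A : set 'rV[R]_n :=
  \bigcap_(C in [set C : set 'rV[R]_n |
                  [/\ convex_set (C : set (convex_lmodType 'rV[R]_n)),
                      closed C & A `<=` C]]) C.

Definition box (a b : 'rV[R]_n) : set 'rV[R]_n :=
  [set x | forall i, a 0 i <= x 0 i <= b 0 i].

Definition box_volume (a b : 'rV[R]_n) : R :=
  \prod_(i < n) Num.max 0 (b 0 i - a 0 i).

(* n-dimensional Lebesgue outer measure, from covers by countably many boxes. *)
Definition lebesgue_outer S : \bar R :=
  ereal_inf [set v | exists (K : set nat) (a b : nat -> 'rV[R]_n),
    S `<=` \bigcup_(k in K) box (a k) (b k) /\
    v = (\esum_(k in K) (box_volume (a k) (b k))%:E)%E].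

(* Lebesgue measure is complete: the sets of measure zero are exactly those   *)
(* of outer measure zero.                                                     *)
Definition lebesgue_null S : Prop := lebesgue_outer S = 0%E.

Definition filippov (X : 'rV[R]_n -> 'rV[R]_n) x : set 'rV[R]_n :=
  \bigcap_(delta in [set d : R | 0 < d])
    \bigcap_(S in lebesgue_null)
      closed_convex_hull (X @` (eball x delta `\` S)).

Definition abs_continuous_on (x : R -> 'rV[R]_n) (a b : R) : Prop :=
  forall eps : R, 0 < eps -> exists2 delta : R, 0 < delta &
    forall (m : nat) (s t : 'I_m -> R),
      (forall k, [/\ a <= s k, s k <= t k & t k <= b]) ->
      trivIset setT (fun k => `]s k, t k[%classic) ->
      \sum_(k < m) (t k - s k) < delta ->
      \sum_(k < m) enorm (x (t k) - x (s k)) < eps.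

(* A function on [0, +oo[ is a total function on R; its values at negative    *)
(* times are irrelevant here.                                                 *)
Definition filippov_solution (X : 'rV[R]_n -> 'rV[R]_n) (x : R -> 'rV[R]_n)
  : Prop :=
  (forall a b : R, 0 <= a -> a <= b -> abs_continuous_on x a b) /\
  {ae (@lebesgue_measure R), forall t : R, 0 <= t ->
     derivable x t 1 /\ filippov X (x t) (x^`()%classic t)}.

End Euclidean.

(* [edge G i j] is (v_i, v_j) \in E, whereas [adj G i j] is the weight of     *)
(* (v_j, v_i).                                                                *)
Record wdigraph (R : realType) (n : nat) := WDigraph {
  edge : rel 'I_n;
  adj : 'M[R]_n;
  adj_ge0 : forall i j, 0 <= adj i j;
  adj_diag : forall i, adj i i = 0;
  adj_gt0 : forall i j, (0 < adj i j) = edge j i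
}.

Section Graphs.
Context {R : realType} {n : nat}.
Implicit Type G : wdigraph R n.

Definition undirected G : Prop := adj G = (adj G)^T.

Definition directed_ring G : Prop :=
  forall i : 'I_n, #|[pred j | edge G i j]| = 1%N /\
                   #|[pred j | edge G j i]| = 1%N.

Definition directed_spanning_tree G : Prop :=
  exists r : 'I_n,
    [/\ forall j, ~~ edge G j r,
        forall i, i != r -> #|[pred j | edge G j i]| = 1%N &
        forall i, i != r -> connect (edge G) r i].

Definition quantizer (Delta z : R) : R :=
  (Num.floor (z / Delta + 2^-1))%:~R * Delta.

Definition quantized_field G (Delta : R) (x : 'rV[R]_n) : 'rV[R]_n :=
  \row_i \sum_(j < n) adj G i j * quantizer Delta (x 0 j - x 0 i).

Definition H1 G (Delta : R) : set 'rV[R]_n :=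
  [set x | forall i j : 'I_n, edge G i j ->
     - (2^-1 * Delta) <= x 0 i - x 0 j <= 2^-1 * Delta].

End Graphs.

(* Main.v *)
Require Import Defs.
From HB Require Import structures.
From mathcomp Require Import all_boot all_order all_algebra.
From mathcomp Require Import all_classical all_reals all_analysis.
From mathcomp Require Import ring lra.
Import Order.TTheory GRing.Theory Num.Theory.
Import numFieldNormedType.Exports.
Local Open Scope classical_set_scope.
Local Open Scope ring_scope.

(**
Only right derivatives are needed.  An absolutely continuous function whose
upper right Dini derivative is almost everywhere at most [c] grows at rate at
most [c].  Filippov velocities satisfy every closed linear inequality that
the field satisfies nearby off a null set.  At a node where a coordinate is
extremal the velocity points inwards, so the sup norm of a solution does not
increase; the solution is bounded, hence Lipschitz.

In each case some nonnegative function [V] of the state does not increase and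
decreases at a uniform positive rate while a given edge has a gap larger than
[Delta / 2].  As the gap is Lipschitz in time, its excess over [Delta / 2] tends
to [0], and a slight contraction towards the origin brings the state into [H1].

For an undirected graph, [V x = \sum_i x i ^+ 2].  This is the only case where
null sets matter: the quantizer is odd except at its jumps.

In a ring or a tree each node [i] has a parent [p i], and
[V x = \sum_i c i * a i * Phi (x (p i) - x i)] with [Phi] the convex primitive
of the quantizer.  Almost everywhere a gap sitting at a jump of the quantizer
has zero derivative, so the choice made there by the Filippov velocity [v] is
irrelevant and [V] has derivative [\sum_i c i * (v i * (v (p i) - v i))].
*)

(** * Monotonicity from Dini derivatives *)

Section DiniMonotonicity.
Set Implicit Arguments.
Unset Strict Implicit.
Unset Printing Implicit Defensive.
Context {R : realType}.
Implicit Types (f : R -> R) (a b t c : R) (l : seq (R * R)).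

(* Non-overlapping subintervals of [a, b], listed from right to left. *)
Fixpoint interval_chain a b l : Prop :=
  if l is p :: l' then [/\ p.1 <= p.2, p.2 <= b & interval_chain a p.1 l']
  else a <= b.

Definition chain_length l : R := \sum_(p <- l) (p.2 - p.1).

Definition chain_variation f l : R := \sum_(p <- l) `|f p.2 - f p.1|.

(** Chains replace indexed disjoint families because a chain grows to the right by consing one
    interval, which is the extension made in [abs_cont_dini_le0]. *)
Definition abs_cont f a b : Prop :=
  forall eps, 0 < eps -> exists2 delta : R, 0 < delta &
    forall l, interval_chain a b l -> chain_length l < delta ->
      chain_variation f l < eps.

Definition dini_le f t c : Prop :=
  forall eps, 0 < eps ->
    \forall s \near t^'+, f s - f t <= (c + eps) * (s - t).

Lemma interval_chain_le a b l : interval_chain a b l -> a <= b.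
Proof.
elim: l b => //= p l IH b [p12 p2b /IH ap1].
exact: le_trans ap1 (le_trans p12 p2b).
Qed.

Lemma interval_chainW a b b' l :
  b <= b' -> interval_chain a b l -> interval_chain a b' l.
Proof.
case: l => /= [bb ab|p l bb [? pb ?]]; first exact: le_trans ab bb.
by split=> //; exact: le_trans pb bb.
Qed.

Lemma interval_chain_nth a b l : interval_chain a b l ->
  forall k, (k < size l)%N ->
  [/\ a <= (nth (0, 0) l k).1, (nth (0, 0) l k).1 <= (nth (0, 0) l k).2 &
      (nth (0, 0) l k).2 <= b].
Proof.
elim: l b => // p l IH b /= [p12 p2b ch] [_|k] /=.
  by split=> //; exact: interval_chain_le ch.
move=> /(IH _ ch)[ha h h']; split=> //.
exact: le_trans h' (le_trans p12 p2b).
Qed.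

Lemma interval_chain_sep a b l : interval_chain a b l ->
  forall k k', (k < k')%N -> (k' < size l)%N ->
  (nth (0, 0) l k').2 <= (nth (0, 0) l k).1.
Proof.
elim: l b => // p l IH b /= [p12 p2b ch] [|k] [|k'] //=.
  by move=> _ k'l; have [] := interval_chain_nth ch k'l.
by move=> kk' k'l; exact: (IH _ ch).
Qed.

(** The intervals of a chain may touch, so each enters through its interior, which has the same
    length and is disjoint from everything to the left of [p.1]. *)
Lemma chain_length_measure (U : set R) a b l : measurable U ->
  interval_chain a b l -> (forall p, p \in l -> `[p.1, p.2] `<=` U) ->
  ((chain_length l)%:E <= lebesgue_measure (U `&` `[a, b]))%E.
Proof.
move=> mU; rewrite /chain_length.
elim: l b => [|p l IH] b /=; first by rewrite big_nil => _ _; exact: measure_ge0.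
move=> [p12 p2b ch] lU; rewrite big_cons.
have ap1 := interval_chain_le ch.
have {}IH := IH _ ch (fun q ql => lU q (@mem_behead _ (p :: l) q ql)).
have mI : measurable (U `&` `[a, p.1]) by exact: measurableI.
have mO : measurable `]p.1, p.2[%classic by [].
apply: (@le_trans _ _ (lebesgue_measure (`]p.1, p.2[ `|` (U `&` `[a, p.1])))).
  rewrite measureU//; last first.
    apply/seteqP; split=> // s [/=]; rewrite !in_itv/= => /andP[h _] [_ /andP[_ h']].
    by move: (lt_le_trans h h'); rewrite ltxx.
  rewrite EFinD; apply: leeD => //.
  suff : ((p.2 - p.1)%:E <= (lebesgue_measure `]p.1, p.2[ : \bar R))%E by [].
  rewrite lebesgue_measure_itv/= lte_fin; case: ltP => h; first by rewrite EFinB.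
  by rewrite lee_fin subr_le0.
apply: le_measure; rewrite ?inE; [exact: measurableU|exact: measurableI|].
move=> s /= [|[Us]]; rewrite !in_itv/= => /andP[h h'].
- split; first by apply: (lU p (mem_head _ _)); rewrite /= in_itv/= (ltW h) ltW.
  by rewrite (le_trans ap1 (ltW h))/= (le_trans (ltW h') p2b).
- by split=> //; rewrite h/= (le_trans h' (le_trans p12 p2b)).
Qed.

Lemma abs_contB_linear f a b c : abs_cont f a b ->
  abs_cont (fun t => f t - c * t) a b.
Proof.
move=> fac eps eps0.
have e2 : 0 < eps / 2 by rewrite divr_gt0.
have [d d0 H] := fac _ e2.
have c1 : 0 < `|c| + 1 by rewrite ltr_wpDl.
exists (Num.min d (eps / 2 / (`|c| + 1))); first by rewrite lt_min d0 !divr_gt0.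
move=> l ch; rewrite lt_min => /andP[ld le].
have {}H := H l ch ld.
have ll : 0 <= chain_length l.
  rewrite /chain_length; elim: l b ch {ld le H fac} => [|p l IH] b /=.
    by rewrite big_nil.
  by move=> [h _ ch]; rewrite big_cons addr_ge0 ?subr_ge0//; exact: IH ch.
have : chain_variation (fun t => f t - c * t) l <=
       chain_variation f l + `|c| * chain_length l.
  rewrite /chain_variation /chain_length mulr_sumr -big_split/=.
  elim: l b ch {ld le H ll fac} => [|p l IH] b /=; first by rewrite !big_nil.
  move=> [h _ ch]; rewrite !big_cons lerD//; last exact: IH ch.
  have -> : f p.2 - c * p.2 - (f p.1 - c * p.1) =
            (f p.2 - f p.1) - c * (p.2 - p.1) by ring.
  rewrite (le_trans (ler_normB _ _))// normrM (ger0_norm (_ : 0 <= p.2 - p.1))//.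
  by rewrite subr_ge0.
move/le_lt_trans; apply.
have h : `|c| * chain_length l <= (`|c| + 1) * chain_length l.
  by rewrite ler_wpM2r// lerDl.
move: le; rewrite ltr_pdivlMr// mulrC => le.
lra.
Qed.

Lemma abs_cont_cont f a b : abs_cont f a b ->
  forall eps, 0 < eps -> exists2 d : R, 0 < d & forall s t,
    a <= s -> s <= t -> t <= b -> t - s < d -> `|f t - f s| < eps.
Proof.
move=> fac eps /fac[d d0 H]; exists d => // s t as_ st tb tsd.
have := H [:: (s, t)]; rewrite /chain_variation /chain_length !big_seq1/=.
by apply.
Qed.

(* Real induction: the exceptional times are covered by an open set of small
   measure, on which absolute continuity makes the variation of [f] small. *)
Lemma abs_cont_dini_le0 f a b (N : set R) : a <= b -> abs_cont f a b ->
  (@lebesgue_measure R).-negligible N ->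
  (forall t, a <= t -> t < b -> ~ N t -> dini_le f t 0) -> f b <= f a.
Proof.
move=> ab fac [A [mA A0 NA]] fN; apply/ler_addgt0Pr => e e0.
have ba1 : 0 < b - a + 1 by rewrite ltr_wpDl// subr_ge0.
(* The error [e] is split into [e / 4] for the slope [e1] over the whole interval, [e / 2] for the
   variation inside [U], and [e / 4] for the final slack. The [+ 1] covers [a = b]. *)
pose e1 := e / 4 / (b - a + 1).
have e10 : 0 < e1 by rewrite !divr_gt0.
have e1ba : e1 * (b - a) <= e / 4.
  by rewrite /e1 -mulrA ler_piMr ?divr_ge0 ?ltW// mulrC ltr_pdivrMr// mul1r ltrDl.
have e2 : 0 < e / 2 by rewrite divr_gt0.
have [d d0 fd] := fac _ e2.
have [U [oU AU UAd]] : exists U : set R, [/\ open U, A `<=` U &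
    (lebesgue_measure (U `\` A) < d%:E)%E].
  by apply: lebesgue_regularity_outer => //; rewrite [ltLHS]A0.
have mU : measurable U by exact: measurable_realfun.open_measurable.
have Ud : (lebesgue_measure U < d%:E)%E.
  have UE : (U `\` A) `|` A = U by apply: (setDKU AU).
  have : (lebesgue_measure U <= lebesgue_measure (U `\` A) + lebesgue_measure A)%E.
    rewrite -[X in (lebesgue_measure X <= _)%E]UE; apply: measureU2 => //.
    exact: measurableD.
  by rewrite [X in (_ + X)%E]A0 adde0 => /le_lt_trans; apply.
have small l : interval_chain a b l -> (forall p, p \in l -> `[p.1, p.2] `<=` U) ->
    chain_variation f l < e / 2.
  move=> ch lU; apply: fd => //; rewrite -lte_fin; apply: le_lt_trans Ud.
  apply: le_trans (chain_length_measure mU ch lU) _.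
  by apply: le_measure; rewrite ?inE//; exact: measurableI.
(* Up to time [t] the growth is paid for by the slope [e1] and by a chain inside [U]. The slack
   [eta] lets [P] pass to a supremum, where the chain of an earlier nearby time is reused. *)
pose P t := forall eta, 0 < eta -> exists l, [/\ interval_chain a t l,
  forall p, p \in l -> `[p.1, p.2] `<=` U &
  f t <= f a + e1 * (t - a) + chain_variation f l + eta].
suff Pb : P b.
  have e4 : 0 < e / 4 by rewrite divr_gt0.
  have [l [ch lU fb]] := Pb _ e4.
  have := small l ch lU; lra.
pose E := [set t | a <= t <= b /\ P t].
have Ea : E a.
  split=> [|eta eta0]; first by rewrite lexx.
  exists [::]; split=> //=; rewrite /chain_variation big_nil subrr mulr0 !addr0.
  by rewrite lerDl ltW.
have supE : has_sup E.
  by split; [exists a|exists b => t [/andP[]]].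
pose T := sup E.
have aT : a <= T by apply: ub_le_sup => //; case: supE.
have Tb : T <= b by apply: ge_sup; [exists a|move=> t [/andP[]]].
have PT : P T.
  move=> eta eta0; have eta2 : 0 < eta / 2 by rewrite divr_gt0.
  have [d' d'0 cf] := abs_cont_cont fac eta2.
  have [s [/andP[as_ sb] Ps] Ts] := sup_adherent d'0 supE.
  have sT : s <= T.
    by apply: ub_le_sup; [case: supE|split=> //; rewrite as_].
  have [l [ch lU fs]] := Ps _ eta2.
  exists l; split=> //; first exact: interval_chainW ch.
  have : `|f T - f s| < eta / 2.
    by apply: cf => //; rewrite ltrBlDr addrC -ltrBlDr.
  have : e1 * (s - a) <= e1 * (T - a) by rewrite ler_wpM2l ?lerD2r// ltW.
  move: fs; have := ler_norm (f T - f s); lra.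
move: Tb; rewrite le_eqVlt => /predU1P[<-//|Tb].
suff [s [Ts sb Ps]] : exists s, [/\ T < s, s <= b & P s].
  suff : s <= T by rewrite leNgt Ts.
  apply: ub_le_sup; first by case: supE.
  by split=> //; rewrite sb andbT (le_trans aT (ltW Ts)).
(* Inside [U] the interval from [T] to [s] joins the chain; outside, [T] is not exceptional and the
   Dini bound with slack [e1] applies. *)
have [UT|nUT] := pselect (U T).
  have /nbhs_ballP[r /= r0 rU] := open_nbhs_nbhs (conj oU UT).
  have [s [Ts sb sr]] : exists s, [/\ T < s, s <= b & s < T + r].
    exists (Num.min b (T + r / 2)); split.
    - by rewrite lt_min Tb ltrDl divr_gt0.
    - by rewrite ge_min lexx.
    - by rewrite gt_min ltrD2l ltr_pdivrMr// ltr_pMr// ltr1n orbT.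
  exists s; split=> // eta eta0.
  have [l [ch lU fT]] := PT _ eta0.
  exists ((T, s) :: l); split.
  - by split=> //=; exact: ltW.
  - move=> p; rewrite in_cons => /predU1P[->|]; last exact: lU.
    move=> u /=; rewrite in_itv/= => /andP[Tu us]; apply: rU.
    rewrite /ball/= ltr_distlC; apply/andP; split.
      by apply: lt_le_trans Tu; rewrite ltrBlDr ltrDl.
    exact: le_lt_trans us sr.
  - rewrite /chain_variation big_cons/=.
    have : 0 <= e1 * (s - T) by rewrite mulr_ge0 ?subr_ge0 ?ltW.
    move: fT; rewrite /chain_variation; have := ler_norm (f s - f T); lra.
have nNT : ~ N T by move/NA/AU.
have [s [Ts sb fs]] : exists s, [/\ T < s, s <= b & f s - f T <= e1 * (s - T)].
  have dT := fN T aT Tb nNT _ e10.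
  have [s [[H1 H2] H3]] : exists s, (T < s /\ s < b) /\ f s - f T <= (0 + e1) * (s - T).
    apply: (@filter_ex _ (T^'+)); near=> s; split.
      split; first by near: s; exact: nbhs_right_gt.
      by near: s; exact: nbhs_right_lt.
    by near: s.
  by exists s; split=> //; [exact: ltW|move: H3; rewrite add0r].
exists s; split=> // eta eta0.
have [l [ch lU fT]] := PT _ eta0.
exists l; split=> //; first by apply: interval_chainW ch; exact: ltW.
lra.
Unshelve. all: by end_near. Qed.

Lemma abs_cont_dini_le f a b c (N : set R) : a <= b -> abs_cont f a b ->
  (@lebesgue_measure R).-negligible N ->
  (forall t, a <= t -> t < b -> ~ N t -> dini_le f t c) ->
  f b - f a <= c * (b - a).
Proof.
move=> ab fac N0 fN.
have := @abs_cont_dini_le0 (fun t => f t - c * t) a b N ab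
  (abs_contB_linear c fac) N0.
have H t : a <= t -> t < b -> ~ N t -> dini_le (fun t => f t - c * t) t 0.
  move=> at_ tb nN e e0; have := fN t at_ tb nN e e0.
  apply: filterS => s; lra.
move=> /(_ H); lra.
Qed.

End DiniMonotonicity.

(** * Right derivatives, and scalar functions of an absolutely continuous curve *)

Section RightDerivatives.
Set Implicit Arguments.
Unset Strict Implicit.
Unset Printing Implicit Defensive.
Context {R : realType}.
Implicit Types (f g : R -> R) (t v w c : R).

Lemma coord_le_enorm n (x : 'rV[R]_n) i : `|x 0 i| <= enorm x.
Proof.
rewrite -sqrtr_sqr ler_wsqrtr// (bigD1 i)//= lerDl.
by apply: sumr_ge0 => j _; exact: sqr_ge0.
Qed.

Lemma norm_le_enorm n (x : 'rV[R]_n) : `|x| <= enorm x.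
Proof.
rewrite [leLHS]/Num.Def.normr/= mx_normrE bigmax_le ?sqrtr_ge0//= => -[i j] _.
by rewrite (ord1 i); exact: coord_le_enorm.
Qed.

Lemma coord_le_norm n (x : 'rV[R]_n) i : `|x 0 i| <= `|x|.
Proof.
rewrite [leRHS]/Num.Def.normr/= mx_normrE.
exact: (le_bigmax _ (fun p => `|x p.1 p.2|) (0, i)).
Qed.

Lemma norm_le_coord n (x : 'rV[R]_n) c :
  0 <= c -> (forall i, `|x 0 i| <= c) -> `|x| <= c.
Proof.
move=> c0 xc; rewrite [leLHS]/Num.Def.normr/= mx_normrE bigmax_le//= => -[i j] _.
by rewrite (ord1 i).
Qed.

(** The Lipschitz bound is asked only along the curve, so that functions that are merely locally
    Lipschitz in the state qualify once the solution is bounded. *)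
Lemma abs_continuous_on_lipschitz n (x : R -> 'rV[R]_n) a b f L :
  abs_continuous_on x a b -> 0 <= L ->
  (forall s t, a <= s -> s <= t -> t <= b ->
     `|f t - f s| <= L * enorm (x t - x s)) ->
  abs_cont f a b.
Proof.
move=> xac L0 fL eps eps0.
have L1 : 0 < L + 1 by rewrite ltr_wpDl.
have e1 : 0 < eps / (L + 1) by rewrite divr_gt0.
have [d d0 xd] := xac _ e1; exists d => // l ch ld.
have := xd (size l) (fun k => (nth (0, 0) l k).1) (fun k => (nth (0, 0) l k).2).
have xE : \sum_(k < size l) enorm (x (nth (0, 0) l k).2 - x (nth (0, 0) l k).1) =
    \sum_(p <- l) enorm (x p.2 - x p.1).
  by rewrite (big_nth (0, 0)) big_mkord.
have lE : \sum_(k < size l) ((nth (0, 0) l k).2 - (nth (0, 0) l k).1) = chain_length l.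
  by rewrite /chain_length (big_nth (0, 0)) big_mkord.
rewrite xE lE => /(_ _ _ ld) H.
have {}H : \sum_(p <- l) enorm (x p.2 - x p.1) < eps / (L + 1).
  apply: H => [k|]; first exact: interval_chain_nth ch _ (ltn_ord k).
  move=> i j _ _ [u /= []]; rewrite !in_itv/= => /andP[ui iu] /andP[uj ju].
  apply/val_inj; case: (ltngtP i j) => // ij.
    have := lt_trans (lt_le_trans ju (interval_chain_sep ch ij (ltn_ord j))) ui.
    by rewrite ltxx.
  have := lt_trans (lt_le_trans iu (interval_chain_sep ch ij (ltn_ord i))) uj.
  by rewrite ltxx.
have : chain_variation f l <= L * \sum_(p <- l) enorm (x p.2 - x p.1).
  rewrite mulr_sumr /chain_variation !(big_nth (0, 0)) big_mkord [leRHS]big_mkord.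
  apply: ler_sum => k _.
  by have [] := interval_chain_nth ch (ltn_ord k); exact: fL.
move/le_lt_trans; apply.
move: H; rewrite ltr_pdivlMr// mulrC; apply: le_lt_trans.
rewrite ler_wpM2r ?lerDl//.
by apply: sumr_ge0 => p _; exact: sqrtr_ge0.
Qed.

Definition rderiv f t v : Prop := (f s - f t) / (s - t) @[s --> t^'+] --> v.

Lemma rderiv_dini f t v : rderiv f t v -> dini_le f t v.
Proof.
move=> /cvgrPdist_le fv e e0; have := fv e e0.
move=> H; near=> s.
have ts : 0 < s - t by rewrite subr_gt0; near: s; exact: nbhs_right_gt.
have : `|v - (f s - f t) / (s - t)| <= e by near: s.
rewrite ler_distlC => /andP[_].
by rewrite ler_pdivrMr.
Unshelve. all: by end_near. Qed.

Lemma rderivN f t v : rderiv f t v -> rderiv (fun s => - f s) t (- v).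
Proof.
move=> fv; rewrite /rderiv.
under eq_fun do rewrite -opprD mulNr.
exact: cvgN.
Qed.

Lemma rderivB f g t v w : rderiv f t v -> rderiv g t w ->
  rderiv (fun s => f s - g s) t (v - w).
Proof.
move=> fv gw; rewrite /rderiv.
have -> : (fun s => (f s - g s - (f t - g t)) / (s - t)) =
   (fun s => (f s - f t) / (s - t) - (g s - g t) / (s - t)).
  by apply/funext => s; rewrite -mulrBl; congr (_ / _); ring.
exact: cvgB.
Qed.

Lemma rderiv_cvg f t v : rderiv f t v -> f s @[s --> t^'+] --> f t.
Proof.
move=> fv.
have st : s - t @[s --> t^'+] --> (0 : R).
  rewrite -(subrr t); apply: cvgB; last exact: cvg_cst.
  exact: cvg_at_right_filter cvg_id.
have := cvgM fv st; rewrite mulr0 => H.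
have : (f s - f t) / (s - t) * (s - t) + f t @[s --> t^'+] --> 0 + f t.
  exact: (cvgD (H _) (cvg_cst (f t))).
rewrite add0r; apply: cvg_trans; apply: near_eq_cvg; near=> s.
have ts : s - t != 0.
  by rewrite gt_eqF// subr_gt0; near: s; exact: nbhs_right_gt.
by rewrite divfK// subrK.
Unshelve. all: by end_near. Qed.

Lemma rderiv_sqr f t v : rderiv f t v ->
  rderiv (fun s => f s ^+ 2) t (2 * (f t * v)).
Proof.
move=> fv; rewrite /rderiv.
have -> : (fun s => (f s ^+ 2 - f t ^+ 2) / (s - t)) =
    (fun s => (f s + f t) * ((f s - f t) / (s - t))).
  by apply/funext => s; rewrite mulrA subr_sqr [X in X / _]mulrC.
rewrite mulrA mulr_natl mulr2n; apply: cvgM => //.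
by apply: cvgD; [exact: rderiv_cvg fv|exact: cvg_cst].
Qed.

Lemma derivable_rderiv n (x : R -> 'rV[R]_n) t i :
  derivable x t 1 -> rderiv (fun s => x s 0 i) t (x^`()%classic t 0 i).
Proof.
move=> xt; have := (derivable_mxP _ _ _).1 xt 0 i.
have -> : x^`()%classic t 0 i = 'D_1 (fun s => x s 0 i) t.
  by rewrite derive1E derive_mx// mxE.
move=> xit; apply/cvgrPdist_le => e e0.
have /cvgrPdist_le/(_ e e0) := xit.
rewrite /dnbhs /at_right !near_withinE => -/nbhs_ballP[d /= d0 H].
near=> s => ts.
have := H (s - t); rewrite /ball/= sub0r normrN.
have -> : 'D_1 (fun s => x s 0 i) t = lim (h^-1 *: (x (h *: 1 + t) 0 i - x t 0 i) @[h --> 0^']) by [].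
move=> /(_ _ _) K.
have := K; rewrite /GRing.scale/= mulr1 subrK mulrC; apply.
  by rewrite distrC; near: s; apply/nbhs_ballP; exists d.
by rewrite subr_eq0 gt_eqF.
Unshelve. all: by end_near. Qed.

Lemma dini_leW f t c c' : c <= c' -> dini_le f t c -> dini_le f t c'.
Proof.
move=> cc fc e e0; have H := fc e e0; near=> s.
have ts : 0 <= s - t.
  by rewrite ltW// subr_gt0; near: s; exact: nbhs_right_gt.
have : f s - f t <= (c + e) * (s - t) by near: s.
move/le_trans; apply; apply: ler_wpM2r => //.
by rewrite lerD2r.
Unshelve. all: by end_near. Qed.

Lemma dini_leM f t c k : 0 <= k -> dini_le f t c ->
  dini_le (fun s => k * f s) t (k * c).
Proof.
move=> k0 fc e e0.
have k1 : 0 < k + 1 by rewrite ltr_wpDl.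
have H := fc (e / (k + 1)) (divr_gt0 e0 k1); near=> s.
have ts : 0 <= s - t.
  by rewrite ltW// subr_gt0; near: s; exact: nbhs_right_gt.
have : f s - f t <= (c + e / (k + 1)) * (s - t) by near: s.
move=> /(ler_wpM2l k0); rewrite mulrBr => /le_trans; apply.
rewrite mulrA ler_wpM2r// mulrDr lerD2l mulrCA ler_piMr ?(ltW e0)//.
by rewrite ler_pdivrMr// mul1r lerDl.
Unshelve. all: by end_near. Qed.

Lemma dini_le_sum (I : finType) (f : I -> R -> R) t (c : I -> R) :
  (forall i, dini_le (f i) t (c i)) ->
  dini_le (fun s => \sum_i f i s) t (\sum_i c i).
Proof.
move=> fc e e0.
have k1 : 0 < #|I|%:R + 1 :> R by rewrite ltr_wpDl.
have H i := fc i (e / (#|I|%:R + 1)) (divr_gt0 e0 k1).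
near=> s.
have ts : 0 <= s - t.
  by rewrite ltW// subr_gt0; near: s; exact: nbhs_right_gt.
have K : forall i, f i s - f i t <= (c i + e / (#|I|%:R + 1)) * (s - t).
  near: s; apply: filter_forall => i; exact: H.
rewrite -sumrB; apply: (le_trans (ler_sum _ (fun i _ => K i))).
rewrite -mulr_suml ler_wpM2r// big_split/= lerD2l sumr_const -[leLHS]mulr_natl.
rewrite mulrCA ler_piMr ?(ltW e0)//.
by rewrite ler_pdivrMr// mul1r lerDl.
Unshelve. all: by end_near. Qed.

End RightDerivatives.

(** * The quantizer *)

Section Quantizer.
Set Implicit Arguments.
Unset Strict Implicit.
Unset Printing Implicit Defensive.
Context {R : realType} (Delta : R).
Hypothesis Delta_gt0 : 0 < Delta.
Implicit Types (z t v : R) (y : R -> R) (k : int).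
Local Notation q := (quantizer Delta).

Lemma quantizer_ge k z : k%:~R * Delta <= z + Delta / 2 -> k%:~R * Delta <= q z.
Proof.
move=> kz; rewrite ler_pM2r// ler_int floor_ge_int_tmp.
by rewrite -(ler_pM2r Delta_gt0) mulrDl divfK ?gt_eqF//; lra.
Qed.

Lemma quantizer_le k z : z + Delta / 2 < (k + 1)%:~R * Delta -> q z <= k%:~R * Delta.
Proof.
move=> kz; rewrite ler_pM2r// ler_int -ltzD1 floor_lt_int.
by rewrite -(ltr_pM2r Delta_gt0) mulrDl divfK ?gt_eqF//; lra.
Qed.

Lemma quantizer_itv z : q z <= z + Delta / 2 < q z + Delta.
Proof.
rewrite /quantizer; set u := z / Delta + 2^-1.
have -> : z + Delta / 2 = u * Delta.
  by rewrite /u mulrDl divfK ?gt_eqF// mulrC.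
rewrite ler_pM2r// floor_le_tmp/= -{3}[Delta]mul1r -mulrDl ltr_pM2r//.
by have := floorD1_gt u; rewrite intrD.
Qed.

Lemma quantizer_uniq k z : k%:~R * Delta <= z + Delta / 2 ->
  z + Delta / 2 < (k + 1)%:~R * Delta -> q z = k%:~R * Delta.
Proof.
by move=> kz zk; apply/eqP; rewrite eq_le quantizer_le// quantizer_ge.
Qed.

Lemma quantizer_ge0 z : - Delta / 2 <= z -> 0 <= q z.
Proof. by move=> zD; have := @quantizer_ge 0 z; rewrite mul0r; apply; lra. Qed.

Lemma quantizer_le0 z : z < Delta / 2 -> q z <= 0.
Proof.
by move=> zD; have := @quantizer_le 0 z; rewrite add0r mul0r mul1r; apply; lra.
Qed.

Lemma quantizer_geD z : Delta / 2 <= z -> Delta <= q z.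
Proof. by move=> zD; have := @quantizer_ge 1 z; rewrite mul1r; apply; lra. Qed.

Lemma quantizer_leD z : z < - Delta / 2 -> q z <= - Delta.
Proof.
move=> zD; have := @quantizer_le (-1) z.
by rewrite addNr mul0r mulN1r; apply; lra.
Qed.

Lemma quantizer0 : q 0 = 0.
Proof.
apply/eqP; rewrite eq_le quantizer_ge0 ?quantizer_le0//; have := Delta_gt0; lra.
Qed.

Lemma quantizer_norm z : `|q z| <= `|z| + Delta.
Proof.
have := quantizer_itv z; have := ler_norm z; have := ler_norm (- z).
have := Delta_gt0; rewrite normrN ler_norml; lra.
Qed.

(* [z] is one of the jumps [(k + 1/2) Delta]. *)
Definition quantizer_jump z : Prop := q z = z + Delta / 2.

Lemma quantizer_locally_const z : ~ quantizer_jump z ->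
  \forall z' \near z, q z' = q z.
Proof.
move=> nj; have /andP[] := quantizer_itv z.
rewrite le_eqVlt => /predU1P[//|qz zq].
have h1 : q z - Delta / 2 < z by lra.
have h2 : z < q z + Delta / 2 by lra.
near=> z'.
have : z' < q z + Delta / 2 by near: z'; exact: lt_nbhsl.
have : q z - Delta / 2 < z' by near: z'; exact: lt_nbhsr.
have -> : q z = (Num.floor (z / Delta + 2^-1))%:~R * Delta by [].
move=> h3 h4; apply: quantizer_uniq; first lra.
by rewrite intrD mulrDl mul1r; lra.
Unshelve. all: by end_near. Qed.

(** Distinct jumps differ by a nonzero multiple of [Delta], so a jump has no other within distance
    [Delta]. Near any other point the quantizer is constant, and [z'] stays strictly above the only
    jump possible for that value. *)
Lemma quantizer_jump_isolated z :
  \forall z' \near z, z' != z -> ~ quantizer_jump z'.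
Proof.
have [j|nj] := pselect (quantizer_jump z); last first.
  have /andP[] := quantizer_itv z.
  rewrite le_eqVlt => /predU1P[//|h1 h2].
  have h3 : q z - Delta / 2 < z by lra.
  near=> z' => _; rewrite /quantizer_jump => j'.
  have qz : q z' = q z by near: z'; exact: quantizer_locally_const.
  have : q z - Delta / 2 < z' by near: z'; exact: lt_nbhsr.
  by rewrite -qz j' addrK ltxx.
have D2 : z < z + Delta by rewrite ltrDl.
have D3 : z - Delta < z by rewrite ltrBlDr ltrDl.
near=> z' => z'z j'.
have h1 : z' < z + Delta by near: z'; exact: lt_nbhsl.
have h2 : z - Delta < z' by near: z'; exact: lt_nbhsr.
have E : (Num.floor (z' / Delta + 2^-1) - Num.floor (z / Delta + 2^-1))%:~R * Delta
    = z' - z.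
  rewrite intrB mulrBl; move: j j'; rewrite /quantizer_jump /quantizer; lra.
move: E; set m := (_ - _)%R => E.
have : (m < 1)%R by rewrite -(ltr_int R) -(ltr_pM2r Delta_gt0) E; lra.
have : (- 1 < m)%R.
  by rewrite -(ltr_int R) -(ltr_pM2r Delta_gt0) E mulrNz mulN1r; lra.
rewrite -lezD1 addNr -[1]add0r ltzD1 => m1 m2.
have m0 : m = 0 by apply/eqP; rewrite eq_le m2.
by move: z'z; rewrite -subr_eq0 -E m0 mul0r eqxx.
Unshelve. all: by end_near. Qed.

(** Off the jumps both inequalities of [quantizer_itv] are strict, hence symmetric under
    negation. *)
Lemma quantizerN z : ~ quantizer_jump z -> q (- z) = - q z.
Proof.
rewrite /quantizer_jump => nj; have /andP[] := quantizer_itv z.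
rewrite le_eqVlt => /predU1P[//|qz zq].
move: qz zq; have -> : q z = (Num.floor (z / Delta + 2^-1))%:~R * Delta by [].
move=> qz zq; rewrite -mulNr -mulrNz; apply: quantizer_uniq.
  by rewrite mulrNz mulNr; lra.
by rewrite intrD mulrNz mulrDl mulNr mul1r; lra.
Qed.

(* The convex primitive of the quantizer, in closed form. *)
Definition quantizer_primitive z : R := q z * z - q z ^+ 2 / 2.
Local Notation Phi := quantizer_primitive.

(* [q z] is the multiple of [Delta] closest to [z], so [quantizer_primitive] is
   the maximum over the multiples [w] of [Delta] of [w * z - w ^+ 2 / 2]. *)
Lemma quantizer_primitive_max k z :
  k%:~R * Delta * z - (k%:~R * Delta) ^+ 2 / 2 <= Phi z.
Proof.
rewrite /Phi -subr_ge0; have := quantizer_itv z.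
rewrite /quantizer; set m := Num.floor _ => /andP[h1 h2].
set a : R := m%:~R in h1 h2 *; set b : R := k%:~R.
have -> : a * Delta * z - (a * Delta) ^+ 2 / 2 -
    (b * Delta * z - (b * Delta) ^+ 2 / 2) =
    Delta / 2 * ((a - b) * (2 * (z - a * Delta) + (a - b) * Delta)) by field.
apply: mulr_ge0; first by rewrite divr_ge0// ltW.
have := Delta_gt0 => D0.
have [mk|mk|mk] := ltrgtP m k; last by rewrite /a /b mk subrr mul0r.
  have ab : a + 1 <= b by rewrite /a /b -(intrD _ m 1) ler_int lezD1.
  by rewrite mulr_le0//; nra.
have ab : b + 1 <= a by rewrite /a /b -(intrD _ k 1) ler_int lezD1.
by rewrite mulr_ge0//; nra.
Qed.

Lemma quantizer_primitive_ge0 z : 0 <= Phi z.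
Proof.
by have := quantizer_primitive_max 0 z; rewrite !mul0r expr0n/= mul0r subr0.
Qed.

(** [q z'] is a subgradient of [Phi] at [z']: the affine function attaining the maximum at [z'] lies
    below [Phi] at [z]. *)
Lemma quantizer_primitiveB z z' : Phi z' - Phi z <= q z' * (z' - z).
Proof.
have := quantizer_primitive_max (Num.floor (z' / Delta + 2^-1)) z.
rewrite -/(q z') /Phi; lra.
Qed.

Lemma quantizer_primitive_lipschitz B z z' : `|z| <= B -> `|z'| <= B ->
  `|Phi z' - Phi z| <= (B + Delta) * `|z' - z|.
Proof.
move=> zB z'B; rewrite ler_norml; apply/andP; split.
  rewrite lerNl opprB; apply: (le_trans (quantizer_primitiveB _ _)).
  apply: (le_trans (ler_norm _)); rewrite normrM distrC ler_wpM2r//.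
  by apply: (le_trans (quantizer_norm z)); rewrite lerD2r.
apply: (le_trans (quantizer_primitiveB _ _)).
apply: (le_trans (ler_norm _)); rewrite normrM ler_wpM2r//.
by apply: (le_trans (quantizer_norm z')); rewrite lerD2r.
Qed.

End Quantizer.

(** * Times at which a function crosses a jump of the quantizer *)

Section JumpTimes.
Set Implicit Arguments.
Unset Strict Implicit.
Unset Printing Implicit Defensive.
Context {R : realType} (Delta : R).
Hypothesis Delta_gt0 : 0 < Delta.
Implicit Types (t v : R) (y : R -> R).
Local Notation q := (quantizer Delta).

(* A crossing with nonzero right derivative is isolated from the right among
   the times at which [y] takes the same value, so there are only countably
   many of them. *)
Lemma rderiv_jump_negligible y : (@lebesgue_measure R).-negligible
  [set t | quantizer_jump Delta (y t) /\ exists2 v, v != 0 & rderiv y t v].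
Proof.
set Z := [set t | _].
suff cZ : countable Z.
  exists Z; split=> //; last exact: countable_lebesgue_measure0.
  exact: countable_measurable.
(* A nonzero right derivative keeps [y] away from the value [y t] during a time [1 / (m + 1)] after
   [t]. *)
have /choice[m mP] : forall t, exists m : nat, Z t ->
    forall s, t < s -> s < t + m.+1%:R^-1 -> y s != y t.
  move=> t; have [Zt|nZt] := pselect (Z t); last by exists 0%N.
  have [_ [v v0 yv]] := Zt.
  have : \forall s \near t^'+, y s != y t.
    have := cvgr_neq0 _ yv v0 => H; near=> s.
    have : (y s - y t) / (s - t) != 0 by near: s; exact: H.
    by apply: contra_neq => ->; rewrite subrr mul0r.
  rewrite /at_right near_withinE => /nbhs_ballP[d /= d0 H].
  exists (Num.truncn d^-1); move=> _ s ts sd; apply: H => //.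
  rewrite /ball/= distrC gtr0_norm ?subr_gt0// ltrBlDl (lt_trans sd)// ltrD2l.
  rewrite invf_plt ?posrE ?ltr0n//.
  exact: truncnS_gt.
apply/countable_injP.
(* The key records [m], the cell of length [1 / (m + 1)] containing [t], and the quantizer level,
   which at a jump determines [y t]. Two times with the same key would be too close to share that
   value. *)
exists (fun t => pickle (m t, (Num.floor (t * (m t).+1%:R),
  Num.floor (y t / Delta + 2^-1)))).
have key t t' : Z t -> Z t' -> t < t' -> m t = m t' ->
    Num.floor (t * (m t).+1%:R) = Num.floor (t' * (m t').+1%:R) ->
    Num.floor (y t / Delta + 2^-1) = Num.floor (y t' / Delta + 2^-1) -> False.
  move=> Zt Zt' tt' mm ff yy.
  have m0 : 0 < (m t).+1%:R :> R by rewrite ltr0n.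
  have : y t' != y t.
    apply: mP => //; rewrite -ltrBlDl -[ltRHS]mul1r ltr_pdivlMr// mulrBl.
    have /andP[h1 _] := floor_itv (t * (m t).+1%:R).
    have /andP[_ h2] := floor_itv (t' * (m t').+1%:R).
    move: h2; rewrite -ff -mm.
    rewrite intrD; lra.
  have [jt _] := Zt; have [jt' _] := Zt'.
  move: jt jt'; rewrite /quantizer_jump /quantizer yy => -> /addIr ->.
  by rewrite eqxx.
move=> t t' /set_mem Zt /set_mem Zt' /(pcan_inj pickleK)[mm ff yy].
by case: (ltgtP t t') => // tt'; [case: (key t t')|case: (key t' t)].
Unshelve. all: by end_near. Qed.

(** Both cases use the subgradient at the later time [s]. Off the jumps [q (y s) = q (y t)] for [s]
    close to [t]; at a jump [q (y s)] is only bounded, but it multiplies a difference quotient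
    tending to [0]. *)
Lemma quantizer_primitive_dini y t v : rderiv y t v ->
  (quantizer_jump Delta (y t) -> v = 0) ->
  dini_le (fun s => quantizer_primitive Delta (y s)) t (q (y t) * v).
Proof.
move=> yv jv; have yc := rderiv_cvg yv.
have [j|nj] := pselect (quantizer_jump Delta (y t)); last first.
  have qc := yc _ (quantizer_locally_const Delta_gt0 nj).
  have H : (q (y t) * ((y s - y t) / (s - t))) @[s --> t^'+] --> q (y t) * v.
    by apply: cvgM => //; exact: cvg_cst.
  move/cvgrPdist_le : H => H e e0; have {}H := H e e0; near=> s.
  have ts : 0 < s - t by rewrite subr_gt0; near: s; exact: nbhs_right_gt.
  apply: (le_trans (quantizer_primitiveB Delta_gt0 _ _)).
  have -> : q (y s) = q (y t) by near: s; exact: qc.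
  have : `|q (y t) * v - q (y t) * ((y s - y t) / (s - t))| <= e by near: s.
  rewrite ler_distlC => /andP[_].
  by rewrite mulrA ler_pdivrMr.
move: yv; rewrite (jv j) mulr0 => /cvgrPdist_le yv e e0.
have C0 : 0 < `|y t| + 1 + Delta by rewrite addr_gt0// ltr_wpDl.
have {}yv := yv (e / (`|y t| + 1 + Delta)) (divr_gt0 e0 C0).
move/cvgrPdist_le : yc => /(_ 1 ltr01) yc.
near=> s.
have ts : 0 < s - t by rewrite subr_gt0; near: s; exact: nbhs_right_gt.
apply: (le_trans (quantizer_primitiveB Delta_gt0 _ _)).
apply: (le_trans (ler_norm _)); rewrite normrM add0r.
have h1 : `|q (y s)| <= `|y t| + 1 + Delta.
  apply: (le_trans (quantizer_norm Delta_gt0 _)); rewrite lerD2r.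
  have : `|y t - y s| <= 1 by near: s.
  have := ler_normB (y t) (y t - y s); rewrite subKr; lra.
have : `|0 - (y s - y t) / (s - t)| <= e / (`|y t| + 1 + Delta) by near: s.
rewrite sub0r normrN normrM normfV (gtr0_norm ts) ler_pdivrMr// => h2.
apply: (le_trans (ler_pM _ _ h1 h2)) => //.
by rewrite mulrA [X in X * _]mulrCA mulfV ?mulr1 ?gt_eqF.
Unshelve. all: by end_near. Qed.

End JumpTimes.

(** * Filippov velocities *)

Section Filippov.
Set Implicit Arguments.
Unset Strict Implicit.
Unset Printing Implicit Defensive.
Context {R : realType} {n : nat}.
Implicit Types (x y v : 'rV[R]_n) (X : 'rV[R]_n -> 'rV[R]_n) (S : set 'rV[R]_n).

Lemma closed_half_space (c : 'I_n -> R) (d : R) :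
  closed [set u : 'rV[R]_n | \sum_i c i * u 0 i <= d].
Proof.
have -> : [set u : 'rV[R]_n | \sum_i c i * u 0 i <= d] =
   (fun u : 'rV[R]_n => \sum_i c i * u 0 i) @^-1` [set r | r <= d] by [].
apply: preimage_closed; last exact: closed_le.
move=> u _; have C1 : 0 < \sum_i `|c i| + 1 by rewrite ltr_wpDl// sumr_ge0.
suff : (\sum_i c i * w 0 i) @[w --> u] --> \sum_i c i * u 0 i by [].
apply/cvgrPdist_le => e e0.
have : \forall w \near u, `|u - w| <= e / (\sum_i `|c i| + 1).
  apply/nbhs_normP; exists (e / (\sum_i `|c i| + 1)); first exact: divr_gt0.
  by move=> w /= /ltW.
apply: filterS => w uw.
rewrite -sumrB; apply: (le_trans (ler_norm_sum _ _ _)).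
apply: (@le_trans _ _ ((\sum_i `|c i|) * (e / (\sum_i `|c i| + 1)))).
  rewrite mulr_suml; apply: ler_sum => i _; rewrite -mulrBr normrM ler_wpM2l//.
  by apply: le_trans uw; have := coord_le_norm (u - w) i; rewrite !mxE.
rewrite mulrCA ler_piMr ?(ltW e0)// ler_pdivrMr// mul1r lerDl//.
Qed.

(** The half-space is closed and convex, so it contains the closed convex hull for one suitable
    radius and the null set [S], hence the whole intersection. *)
Lemma filippov_le X x v S (c : 'I_n -> R) (d : R) : lebesgue_null S ->
  (\forall y \near x, ~ S y -> \sum_i c i * X y 0 i <= d) ->
  filippov X x v -> \sum_i c i * v 0 i <= d.
Proof.
move=> S0 /nbhs_normP[e /= e0 He] H.
apply: (H e e0 S S0 [set u : 'rV[R]_n | \sum_i c i * u 0 i <= d]); split.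
- move=> y z l /set_mem /= hy /set_mem /= hz; apply/mem_set => /=.
  have -> : \sum_i c i * (conv l (y : convex_lmodType 'rV[R]_n) z : 'rV[R]_n) 0 i =
     l%:num * (\sum_i c i * y 0 i) + (1 - l%:num) * (\sum_i c i * z 0 i).
    rewrite !mulr_sumr -big_split/=; apply: eq_bigr => i _.
    by rewrite /conv/= !mxE /unstable.onem; ring.
  have l0 : 0 <= l%:num by [].
  have l1 : l%:num <= 1 by [].
  nra.
- exact: closed_half_space.
- move=> _ [y [ye nSy] <-] /=; apply: He => //=.
  by rewrite distrC; apply: le_lt_trans ye; exact: norm_le_enorm.
Qed.

Lemma lebesgue_outer_ge0 S : (0 <= lebesgue_outer S)%E.
Proof.
apply: le_ereal_inf_tmp => _ [K [a [b [_ ->]]]]; apply: esum_ge0 => k _.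
by rewrite lee_fin; apply: prodr_ge0 => i _; rewrite le_max lexx.
Qed.

Lemma lebesgue_null_set0 : lebesgue_null (set0 : set 'rV[R]_n).
Proof.
apply/eqP; rewrite eq_le lebesgue_outer_ge0 andbT.
apply: ereal_inf_lbound; exists set0, (fun=> 0), (fun=> 0); split=> //.
by rewrite esum_set0.
Qed.

(* At scale [1 / N], each of the finitely many hyperplanes is covered inside
   the cube by [N] boxes with two edges of length [1 / N] and all others of
   length [1]. *)
Lemma lebesgue_null_diagonals x : lebesgue_null [set y |
  (forall l, `|y 0 l - x 0 l| < 2^-1) /\
  exists i j, i != j /\ y 0 j - y 0 i = x 0 j - x 0 i].
Proof.
apply/eqP; rewrite eq_le lebesgue_outer_ge0 andbT.
apply/lee_addgt0Pr => e e0; rewrite add0e.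
pose n2 : R := (n * n)%:R.
(* There are at most [n * n * N] boxes, each of volume [1 / N ^ 2], so the total is at most
   [n2 / N < e]. *)
pose N := (Num.truncn (n2 / e)).+1.
have N0 : 0 < N%:R :> R by rewrite ltr0n.
have n2N : n2 / N%:R < e.
  by rewrite ltr_pdivrMr// mulrC -ltr_pdivrMr// truncnS_gt.
pose T := ('I_n * 'I_n * 'I_N)%type.
pose s : seq T := enum [pred t : T | t.1.1 != t.1.2].
(* The box of [((i, j), m)] restricts the coordinates [i] and [j] to the [m]-th of [N] cells around
   [x]. On the diagonal the two offsets from [x] agree, so one index [m] serves both. *)
pose lo (t : T) l : R := if (l == t.1.1) || (l == t.1.2)
  then x 0 l - 2^-1 + t.2%:R / N%:R else x 0 l - 2^-1.
pose hi (t : T) l : R := if (l == t.1.1) || (l == t.1.2)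
  then x 0 l - 2^-1 + t.2.+1%:R / N%:R else x 0 l + 2^-1.
pose a k : 'rV[R]_n := if onth s k is Some t then \row_l lo t l else 0.
pose b k : 'rV[R]_n := if onth s k is Some t then \row_l hi t l else 0.
have vol k : (k < size s)%N -> box_volume (a k) (b k) = N%:R^-1 ^+ 2.
  rewrite -onthTE /a /b; case E : (onth s k) => [[[i j] m]|//] _.
  have : (i, j, m) \in s by apply/onthP; exists k.
  rewrite mem_enum inE/= => ij.
  have hl l : (\row_l hi (i, j, m) l) 0 l - (\row_l lo (i, j, m) l) 0 l =
      if (l == i) || (l == j) then N%:R^-1 else 1.
    rewrite !mxE /hi /lo/=; case: ifP => _; last by field.
    rewrite -[m.+1]addn1 natrD mulrDl mul1r; ring.
  rewrite /box_volume; under eq_bigr do rewrite hl.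
  rewrite (bigD1 i)//= eqxx/= (bigD1 j)/=; last by rewrite eq_sym.
  rewrite eqxx orbT big1 ?mulr1.
    by rewrite max_r ?expr2// invr_ge0 ltW.
  by move=> l /andP[/negbTE-> /negbTE->]/=; rewrite max_r.
apply: ge_ereal_inf; exists ((size s)%:R * N%:R^-1 ^+ 2)%:E; last first.
  rewrite lee_fin; apply: le_trans (ltW n2N).
  have : (size s <= n * n * N)%N.
    by rewrite /s -cardE (leq_trans (max_card _))// !card_prod !card_ord.
  rewrite -(ler_nat R) natrM -/n2 => sN.
  apply: (le_trans (ler_wpM2r _ sN)); first by rewrite exprn_ge0// invr_ge0 ltW.
  by rewrite expr2 mulrA mulfK ?gt_eqF.
exists `I_(size s), a, b; split.
  move=> y [yx [i [j [ij yij]]]].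
  pose u := (y 0 i - x 0 i + 2^-1) * N%:R.
  have := yx i; rewrite ltr_norml => /andP[h1 h2].
  have u0 : 0 <= u by rewrite mulr_ge0 ?(ltW N0)//; lra.
  have uN : (Num.truncn u < N)%N.
    by rewrite truncn_lt_nat// /u -[ltRHS]mul1r ltr_pM2r//; lra.
  have /andP[um uM] := truncn_itv u0.
  have /onthP[k ks] : (i, j, Ordinal uN) \in s by rewrite mem_enum inE.
  exists k; first by rewrite /= -onthTE ks.
  move: um uM; rewrite -ler_pdivrMr// -ltr_pdivlMr// => um uM.
  rewrite /box/= /a /b ks => l; rewrite !mxE /lo /hi/=.
  have := yx l; rewrite ltr_norml => /andP[h3 h4].
  case: ifPn => [/orP[]/eqP->|_]; apply/andP; split; lra.
transitivity (\esum_(k in `I_(size s)) (N%:R^-1 ^+ 2 : R)%:E)%E.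
  by rewrite esum_fset// -fsbig_ord sumEFin sumr_const card_ord mulr_natl.
by apply: eq_esum => k /= ks; rewrite vol.
Qed.

End Filippov.

(** * Bounds along a solution, and velocities at almost every time *)

Section Solutions.
Set Implicit Arguments.
Unset Strict Implicit.
Unset Printing Implicit Defensive.
Context {R : realType} {n : nat}.
Variables (G : wdigraph R n) (Delta : R).
Hypothesis Delta_gt0 : 0 < Delta.
Local Notation X := (quantized_field G Delta).
Local Notation q := (quantizer Delta).
Implicit Types (v y : 'rV[R]_n) (V : R -> R) (i j : 'I_n).

Lemma near_coordB y i j (P : R -> Prop) :
  (\forall z \near (y 0 j - y 0 i), P z) ->
  \forall u \near y, P ((u : 'rV[R]_n) 0 j - u 0 i).
Proof.
have : ((u : 'rV[R]_n) 0 j - u 0 i) @[u --> y] --> y 0 j - y 0 i.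
  exact: (cvgB (@coord_continuous R 1 n 0 j y) (@coord_continuous R 1 n 0 i y)).
exact.
Qed.

Lemma near_forall_coordB y i (P : R -> Prop) :
  (forall j, \forall z \near (y 0 j - y 0 i), P z) ->
  \forall u \near y, forall j, P ((u : 'rV[R]_n) 0 j - u 0 i).
Proof.
move=> yP; apply: (@filter_forall _ _
  (fun j (u : 'rV[R]_n) => P (u 0 j - u 0 i)) (nbhs y) _) => j.
exact: near_coordB.
Qed.

Lemma filippov_coord_le y v i d : filippov X y v ->
  (\forall u \near y, X u 0 i <= d) -> v 0 i <= d.
Proof.
move=> yv Xd.
have E (w : 'rV[R]_n) : \sum_k (k == i)%:R * w 0 k = w 0 i.
  rewrite (bigD1 i)//= eqxx mul1r big1 ?addr0// => k /negbTE->.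
  by rewrite mul0r.
rewrite -E; apply: (filippov_le (@lebesgue_null_set0 R n) _ yv).
by apply: filterS Xd => u ud _; rewrite E.
Qed.

Lemma filippov_coord_ge y v i d : filippov X y v ->
  (\forall u \near y, d <= X u 0 i) -> d <= v 0 i.
Proof.
move=> yv Xd.
have E (w : 'rV[R]_n) : \sum_k - (k == i)%:R * w 0 k = - w 0 i.
  rewrite (bigD1 i)//= eqxx mulN1r big1 ?addr0// => k /negbTE->.
  by rewrite oppr0 mul0r.
rewrite -lerN2 -E; apply: (filippov_le (@lebesgue_null_set0 R n) _ yv).
by apply: filterS Xd => u ud _; rewrite E lerN2.
Qed.

(** Gaps that are nonpositive at [y] stay below the threshold [Delta / 2] in a neighbourhood, where
    all interactions acting on [i] are nonpositive. *)
Lemma filippov_max_le0 y v i : filippov X y v ->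
  (forall j, y 0 j <= y 0 i) -> v 0 i <= 0.
Proof.
move=> yv ymax; apply: (filippov_coord_le yv).
have D2 : 0 < Delta / 2 by rewrite divr_gt0.
have : \forall u \near y, forall j, (u : 'rV[R]_n) 0 j - u 0 i < Delta / 2.
  apply: (@near_forall_coordB y i (fun z => z < Delta / 2)) => j; apply: lt_nbhsl.
  by apply: le_lt_trans D2; rewrite subr_le0.
apply: filterS => u ui; rewrite mxE; apply: sumr_le0 => j _.
by rewrite mulr_ge0_le0 ?adj_ge0//; exact: quantizer_le0.
Qed.

Lemma filippov_min_ge0 y v i : filippov X y v ->
  (forall j, y 0 i <= y 0 j) -> 0 <= v 0 i.
Proof.
move=> yv ymin; apply: (filippov_coord_ge yv).
have D2 : - Delta / 2 < 0 by rewrite mulNr oppr_lt0 divr_gt0.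
have : \forall u \near y, forall j, - Delta / 2 < (u : 'rV[R]_n) 0 j - u 0 i.
  apply: (@near_forall_coordB y i (fun z => - Delta / 2 < z)) => j; apply: lt_nbhsr.
  by apply: lt_le_trans D2 _; rewrite subr_ge0.
apply: filterS => u ui; rewrite mxE; apply: sumr_ge0 => j _.
by rewrite mulr_ge0 ?adj_ge0//; apply: quantizer_ge0; rewrite // ltW.
Qed.

(** Gaps are at most [2 * B]; the [1] allows for moving to nearby points and [Delta] for rounding.
    The double sum dominates the total weight of any single row. *)
Definition speed_bound (B : R) : R :=
  (\sum_i \sum_j adj G i j) * (2 * B + 1 + Delta).

Lemma speed_bound_ge0 B : 0 <= B -> 0 <= speed_bound B.
Proof.
move=> B0; apply: mulr_ge0.
  by apply: sumr_ge0 => i _; apply: sumr_ge0 => j _; exact: adj_ge0.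
by have := Delta_gt0; lra.
Qed.

Lemma filippov_speed_le y v i B : `|y| <= B -> filippov X y v ->
  `|v 0 i| <= speed_bound B.
Proof.
move=> yB yv.
have XB : \forall u \near y, `|X u 0 i| <= speed_bound B.
  have : \forall u \near y, forall j, `|(u : 'rV[R]_n) 0 j - u 0 i| < 2 * B + 1.
    apply: (@near_forall_coordB y i (fun z => `|z| < 2 * B + 1)) => j.
    have h : `|y 0 j - y 0 i| < 2 * B + 1.
      have := ler_normB (y 0 j) (y 0 i).
      have := coord_le_norm y i; have := coord_le_norm y j; lra.
    have : `|z| @[z --> y 0 j - y 0 i] --> `|y 0 j - y 0 i| by exact: norm_continuous.
    by move=> /cvgr_lt; apply.
  apply: filterS => u ui; rewrite mxE; apply: (le_trans (ler_norm_sum _ _ _)).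
  apply: (@le_trans _ _ ((\sum_j adj G i j) * (2 * B + 1 + Delta))).
    rewrite mulr_suml; apply: ler_sum => j _.
    rewrite normrM (ger0_norm (adj_ge0 _ _ _)) ler_wpM2l ?adj_ge0//.
    by apply: (le_trans (quantizer_norm Delta_gt0 _)); rewrite lerD2r ltW.
  apply: ler_wpM2r.
    by have := normr_ge0 y; have := Delta_gt0; lra.
  rewrite [leRHS](bigD1 i)//= lerDl.
  by apply: sumr_ge0 => k _; apply: sumr_ge0 => j _; exact: adj_ge0.
rewrite ler_norml; apply/andP; split.
  by apply: (filippov_coord_ge yv); apply: filterS XB => u; rewrite ler_norml => /andP[].
by apply: (filippov_coord_le yv); apply: filterS XB => u; rewrite ler_norml => /andP[].
Qed.

Variable x : R -> 'rV[R]_n.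
Hypothesis x_sol : filippov_solution X x.

(** The last clause says that a gap sitting at a jump has zero derivative. By
    [rderiv_jump_negligible], applied to the finitely many pairs, it costs only a null set of
    times. *)
Definition velocity t v : Prop := [/\
  forall i, rderiv (fun s => x s 0 i) t (v 0 i),
  filippov X (x t) v &
  forall i j, quantizer_jump Delta (x t 0 j - x t 0 i) -> v 0 j = v 0 i].

Lemma solution_velocity :
  {ae (@lebesgue_measure R), forall t, 0 <= t -> exists v, velocity t v}.
Proof.
have [_ xae] := x_sol.
pose J (ij : 'I_n * 'I_n) := [set t | quantizer_jump Delta (x t 0 ij.2 - x t 0 ij.1) /\
  exists2 v, v != 0 & rderiv (fun s => x s 0 ij.2 - x s 0 ij.1) t v].
have Jae : {ae (@lebesgue_measure R), forall t, forall ij, ~ J ij t}.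
  apply: filter_forall => ij.
  have := rderiv_jump_negligible Delta (fun s => x s 0 ij.2 - x s 0 ij.1).
  by apply: negligibleS => t /= /contrapT.
apply: (@filterS2 _ _ (ae_filter_ringOfSetsType (@lebesgue_measure R)) _ _ _ _ xae Jae) => t xt Jt t0.
have [dx Fx] := xt t0; exists (x^`()%classic t); split=> //.
  by move=> i; exact: derivable_rderiv.
move=> i j jump; apply/eqP; rewrite -subr_eq0; apply/negPn/negP => v0.
apply: (Jt (i, j)); split=> //; exists (x^`()%classic t 0 j - x^`()%classic t 0 i) => //.
by apply: rderivB; exact: derivable_rderiv.
Qed.

Lemma solution_dini_le V a b c L : 0 <= a -> a <= b -> 0 <= L ->
  (forall s t, a <= s -> s <= t -> t <= b ->
     `|V t - V s| <= L * enorm (x t - x s)) ->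
  (forall t v, a <= t -> t < b -> velocity t v -> dini_le V t c) ->
  V b - V a <= c * (b - a).
Proof.
move=> a0 ab L0 VL Vc; have [xac _] := x_sol.
have Vac := abs_continuous_on_lipschitz (xac a b a0 ab) L0 VL.
apply: (abs_cont_dini_le ab Vac solution_velocity) => t at_ tb nN.
have : 0 <= t -> exists v, velocity t v by exact: contrapT.
by move=> /(_ (le_trans a0 at_))[v]; exact: Vc.
Qed.

(** Just after [t], a signed coordinate strictly below the norm remains so by continuity, and one
    equal to the norm is extremal, so its right derivative is nonpositive. *)
Lemma solution_norm_noninc a b : 0 <= a -> a <= b -> `|x b| <= `|x a|.
Proof.
move=> a0 ab; rewrite -subr_le0 -[0](mul0r (b - a)).
apply: (@solution_dini_le (fun t => `|x t|) a b 0 1) => //.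
  move=> s t _ _ _; rewrite mul1r; apply: (le_trans (ler_dist_dist _ _)).
  exact: norm_le_enorm.
move=> t v _ _ [xv Fv _] e e0.
have up j : \forall s \near t^'+, x s 0 j <= `|x t| + e * (s - t).
  have := le_trans (ler_norm _) (coord_le_norm (x t) j).
  rewrite le_eqVlt => /predU1P[xj|xj].
    have : dini_le (fun s => x s 0 j) t 0.
      apply: dini_leW (rderiv_dini (xv j)); apply: (filippov_max_le0 Fv) => k.
      by rewrite xj (le_trans (ler_norm _))// coord_le_norm.
    by move=> /(_ e e0); apply: filterS => s; rewrite xj add0r lerBlDl.
  have H := cvgr_lt _ (rderiv_cvg (xv j)) _ xj; near=> s.
  have ts : 0 <= e * (s - t).
    rewrite mulr_ge0 ?(ltW e0)// ltW// subr_gt0.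
    by near: s; exact: nbhs_right_gt.
  have : x s 0 j < `|x t| by near: s; exact: H.
  lra.
have dn j : \forall s \near t^'+, - x s 0 j <= `|x t| + e * (s - t).
  have := coord_le_norm (x t) j; rewrite -[X in X <= _]normrN => /(le_trans (ler_norm _)).
  rewrite le_eqVlt => /predU1P[xj|xj].
    have : dini_le (fun s => - x s 0 j) t 0.
      apply: dini_leW (rderiv_dini (rderivN (xv j))).
      rewrite oppr_le0; apply: (filippov_min_ge0 Fv) => k.
      rewrite -lerN2 xj; apply: (le_trans (ler_norm _)).
      by rewrite normrN; exact: coord_le_norm.
    by move=> /(_ e e0); apply: filterS => s; rewrite xj add0r lerBlDl.
  have H := cvgr_lt _ (rderiv_cvg (rderivN (xv j))) _ xj; near=> s.
  have ts : 0 <= e * (s - t).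
    rewrite mulr_ge0 ?(ltW e0)// ltW// subr_gt0.
    by near: s; exact: nbhs_right_gt.
  have : - x s 0 j < `|x t| by near: s; exact: H.
  lra.
near=> s.
have ts : 0 <= e * (s - t).
  rewrite mulr_ge0 ?(ltW e0)// ltW// subr_gt0.
  by near: s; exact: nbhs_right_gt.
rewrite add0r lerBlDl; apply: norm_le_coord => [|j]; first by rewrite addr_ge0.
rewrite ler_norml; apply/andP; split; last by move: j; near: s; exact: filter_forall up.
by rewrite lerNl; move: j; near: s; exact: filter_forall dn.
Unshelve. all: by end_near. Qed.

Lemma solution_bounded t : 0 <= t -> `|x t| <= `|x 0|.
Proof. by move=> t0; apply: solution_norm_noninc. Qed.

Lemma solution_coord_lipschitz s t i : 0 <= s -> s <= t ->
  `|x t 0 i - x s 0 i| <= speed_bound `|x 0| * (t - s).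
Proof.
move=> s0 st; rewrite ler_norml; apply/andP; split.
  rewrite lerNl opprB -[x s 0 i]opprK addrC.
  apply: (@solution_dini_le (fun r => - x r 0 i) s t _ 1) => //.
    move=> r r' _ _ _; rewrite mul1r opprK addrC distrC.
    by have := coord_le_enorm (x r' - x r) i; rewrite !mxE.
  move=> r v sr _ [xv Fv _]; apply: dini_leW (rderiv_dini (rderivN (xv i))).
  apply: (le_trans (ler_norm _)); rewrite normrN; apply: filippov_speed_le Fv.
  exact/solution_bounded/(le_trans s0 sr).
apply: (@solution_dini_le (fun r => x r 0 i) s t _ 1) => //.
  move=> r r' _ _ _; rewrite mul1r.
  by have := coord_le_enorm (x r' - x r) i; rewrite !mxE.
move=> r v sr _ [xv Fv _]; apply: dini_leW (rderiv_dini (xv i)).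
apply: (le_trans (ler_norm _)); apply: filippov_speed_le Fv.
exact/solution_bounded/(le_trans s0 sr).
Qed.

Lemma solution_gap_lipschitz i j (k s t : R) : 0 <= s -> s <= t ->
  `|(`|x t 0 i - x t 0 j| - k) - (`|x s 0 i - x s 0 j| - k)| <=
  2 * speed_bound `|x 0| * (t - s).
Proof.
move=> s0 st.
rewrite [X in `|X| <= _](_ : _ = `|x t 0 i - x t 0 j| - `|x s 0 i - x s 0 j|); last by ring.
apply: (le_trans (ler_dist_dist _ _)).
have -> : x t 0 i - x t 0 j - (x s 0 i - x s 0 j) =
  (x t 0 i - x s 0 i) - (x t 0 j - x s 0 j) by ring.
apply: (le_trans (ler_normB _ _)).
have := solution_coord_lipschitz i s0 st.
have := solution_coord_lipschitz j s0 st; lra.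
Qed.

End Solutions.

(** * Convergence criteria *)

Section Convergence.
Set Implicit Arguments.
Unset Strict Implicit.
Unset Printing Implicit Defensive.
Context {R : realType}.

(** If [g t >= eps], then [g] stays positive for a time [r = eps / (L + 1)], during which [V] loses
    [d * r]. This is impossible once [V] is within [d * r] of its infimum. *)
Lemma descent_limsup_le0 (V g : R -> R) (L d : R) : 0 < d -> 0 <= L ->
  (forall t, 0 <= V t) ->
  (forall a b, 0 <= a -> a <= b -> V b <= V a) ->
  (forall a b, 0 <= a -> a <= b -> (forall t, a <= t -> t <= b -> 0 < g t) ->
     V b - V a <= - d * (b - a)) ->
  (forall s t, 0 <= s -> s <= t -> `|g t - g s| <= L * (t - s)) ->
  forall eps, 0 < eps -> \forall t \near +oo, g t < eps.
Proof.
move=> d0 L0 V0 Vmono Vd gL eps eps0.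
pose r := eps / (L + 1).
have L1 : 0 < L + 1 by rewrite ltr_wpDl.
have r0 : 0 < r by rewrite divr_gt0.
have Lr : L * r < eps by rewrite /r mulrCA gtr_pMr// ltr_pdivrMr// mul1r ltrDl.
pose E := [set V t | t in [set t | 0 <= t]].
have infE : has_inf E by split; [exists (V 0), 0 => //=|exists 0 => _ [t _ <-]].
have [_ [T /= T0 <-] VT] := inf_adherent (mulr_gt0 d0 r0) infE.
exists T; split; first exact: num_real.
move=> t Tt; rewrite ltNge; apply/negP => gt.
have t0 := le_trans T0 (ltW Tt).
have tr : t <= t + r by rewrite lerDl ltW.
have : V (t + r) - V t <= - d * (t + r - t).
  apply: Vd => // s ts st.
  have := gL t s t0 ts; rewrite ler_norml => /andP[h _].
  have : L * (s - t) <= L * r by rewrite ler_wpM2l// lerBlDl.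
  lra.
have : inf E <= V (t + r).
  apply: ge_inf; first by case: infE.
  by exists (t + r) => //=; exact: le_trans t0 tr.
have := Vmono _ _ T0 (ltW Tt).
have -> : - d * (t + r - t) = - (d * r) by ring.
lra.
Qed.

Lemma enorm_le_coord n (v : 'rV[R]_n) c : 0 <= c ->
  (forall i, `|v 0 i| <= c) -> enorm v <= n%:R * c.
Proof.
move=> c0 vc; have nc : 0 <= n%:R * c by rewrite mulr_ge0.
rewrite -[leRHS]ger0_norm// -sqrtr_sqr ler_wsqrtr//.
apply: (@le_trans _ _ (\sum_(i < n) c ^+ 2)).
  by apply: ler_sum => i _; rewrite -real_normK ?num_real// lerXn2r ?nnegrE.
rewrite sumr_const card_ord exprMn -[leLHS]mulr_natl ler_wpM2r ?sqr_ge0//.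
by rewrite -natrX ler_nat; case: n {v vc nc} => // n; rewrite leq_pmulr.
Qed.

Lemma dist_to_ge0 n (x : 'rV[R]_n) A : 0 <= dist_to x A.
Proof.
rewrite /dist_to; set E := [set _ | _ in _].
have [->|/set0P E0] := eqVneq E set0; first by rewrite inf0.
by apply: lb_le_inf => // _ [y _ <-]; exact: sqrtr_ge0.
Qed.

Lemma dist_to_le n (x y : 'rV[R]_n) A : A y -> dist_to x A <= enorm (x - y).
Proof.
move=> Ay; apply: ge_inf; last by exists y.
by exists 0 => _ [z _ <-]; exact: sqrtr_ge0.
Qed.

(* A bounded point violating the constraints by at most [eta] is brought into
   [H1] by the contraction of ratio [(Delta / 2) / (Delta / 2 + eta)]. *)
Lemma cvg_dist_to_H1 n (G : wdigraph R n) (Delta B : R) (x : R -> 'rV[R]_n) :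
  0 < Delta -> (forall t, 0 <= t -> `|x t| <= B) ->
  (forall i j, edge G i j -> forall eps, 0 < eps ->
     \forall t \near +oo, `|x t 0 i - x t 0 j| - Delta / 2 < eps) ->
  dist_to (x t) (H1 G Delta) @[t --> +oo] --> (0 : R).
Proof.
move=> D0 xB xH; apply/cvgrPdist_lt => eps eps0.
have B0 : 0 <= B by apply: le_trans (xB 0 _).
pose C := n%:R * B + 1.
have nB0 : 0 <= n%:R * B by rewrite mulr_ge0.
have C0 : 0 < C by rewrite ltr_wpDl.
(* The contraction moves the point by at most [n * B * eta / (Delta / 2 + eta)], which is then less
   than [eps]. *)
pose eta := Delta / 2 * (eps / C).
have eta0 : 0 < eta by rewrite !mulr_gt0 ?invr_gt0.
have xeta : \forall t \near +oo, forall ij : 'I_n * 'I_n,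
    edge G ij.1 ij.2 -> `|x t 0 ij.1 - x t 0 ij.2| - Delta / 2 < eta.
  apply: filter_forall => -[i j].
  have [ij|nij] := boolP (edge G i j); last by near=> t.
  by have := xH i j ij eta eta0; apply: filterS.
near=> t.
have t0 : 0 <= t by near: t; apply: nbhs_pinfty_ge; rewrite num_real.
have xt : forall ij : 'I_n * 'I_n,
    edge G ij.1 ij.2 -> `|x t 0 ij.1 - x t 0 ij.2| - Delta / 2 < eta.
  by near: t.
pose lam := Delta / 2 / (Delta / 2 + eta).
have De : 0 < Delta / 2 + eta by rewrite addr_gt0// divr_gt0.
have lam0 : 0 <= lam by rewrite divr_ge0 ?ltW ?divr_gt0.
have Hy : H1 G Delta (lam *: x t).
  move=> i j ij; rewrite !mxE -mulrBr -ler_norml normrM ger0_norm//.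
  rewrite /lam mulrAC ler_pdivrMr// [2^-1 * _]mulrC ler_wpM2l ?divr_ge0 ?ltW//.
  by have := xt (i, j) ij; rewrite /=; lra.
rewrite sub0r normrN ger0_norm ?dist_to_ge0//.
apply: (le_lt_trans (dist_to_le _ Hy)).
have lamE : 1 - lam = eta / (Delta / 2 + eta).
  by rewrite /lam; field; rewrite gt_eqF//; lra.
have lam1 : 0 <= 1 - lam by rewrite lamE divr_ge0 ?ltW.
have -> : x t - lam *: x t = (1 - lam) *: x t by rewrite scalerBl scale1r.
apply: (@le_lt_trans _ _ (n%:R * ((1 - lam) * B))).
  apply: enorm_le_coord => [|i]; first exact: mulr_ge0.
  rewrite mxE normrM ger0_norm// ler_wpM2l//.
  by apply: le_trans (xB t t0); exact: coord_le_norm.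
rewrite mulrCA lamE mulrAC ltr_pdivrMr//.
apply: (@lt_le_trans _ _ (eta * C)); first by rewrite ltr_pM2l// ltrDl.
rewrite /eta -mulrA divfK ?gt_eqF// mulrC ler_pM2l// lerDl.
by rewrite ltW.
Unshelve. all: by end_near. Qed.

End Convergence.

(** * Rings and trees *)

Section ParentField.
Set Implicit Arguments.
Unset Strict Implicit.
Unset Printing Implicit Defensive.
Context {R : realType} {n : nat}.
Variables (G : wdigraph R n) (Delta : R).
Hypothesis Delta_gt0 : 0 < Delta.
Local Notation X := (quantized_field G Delta).
Local Notation q := (quantizer Delta).
Variables (p : 'I_n -> 'I_n) (a : 'I_n -> R).
Hypothesis a_gt0 : forall i, 0 < a i.
Implicit Types (i j k : 'I_n).

(** This is what remains of [v i = a i * q (y (p i) - y i)] for every Filippov velocity, jumps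
    included. For gaps smaller than [Delta / 2] the first two clauses together force [v i = 0].
    Strict thresholds make the notion odd. *)
Definition sign_compatible (y v : 'I_n -> R) : Prop := forall i,
  [/\ y (p i) - y i < Delta / 2 -> v i <= 0,
      - Delta / 2 < y (p i) - y i -> 0 <= v i,
      Delta / 2 < y (p i) - y i -> a i * Delta <= v i &
      y (p i) - y i < - Delta / 2 -> v i <= - (a i * Delta)].

Lemma sign_compatibleN y v : sign_compatible y v ->
  sign_compatible (fun i => - y i) (fun i => - v i).
Proof. by move=> yv i; have [h1 h2 h3 h4] := yv i; split=> ?; lra. Qed.

Definition dissipative (c : 'I_n -> R) (d : R) : Prop :=
  forall y v, sign_compatible y v ->
    \sum_i c i * (v i * (v (p i) - v i)) <= 0 /\
    forall k, Delta / 2 < `|y (p k) - y k| ->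
      \sum_i c i * (v i * (v (p i) - v i)) <= - d.

Section Descent.
Hypothesis X_parent : forall y i, X y 0 i = a i * q (y 0 (p i) - y 0 i).

(** Coordinate [i] of the field depends on one gap only, so off the jumps of that gap it is locally
    constant, whatever the other gaps do. *)
Lemma filippov_parent (y v : 'rV[R]_n) i : filippov X y v ->
  ~ quantizer_jump Delta (y 0 (p i) - y 0 i) ->
  v 0 i = a i * q (y 0 (p i) - y 0 i).
Proof.
move=> yv nj; have E := near_coordB (quantizer_locally_const Delta_gt0 nj).
apply/eqP; rewrite eq_le; apply/andP; split.
  by apply: (filippov_coord_le yv); apply: filterS E => u uE; rewrite X_parent uE.
by apply: (filippov_coord_ge yv); apply: filterS E => u uE; rewrite X_parent uE.
Qed.

Lemma filippov_sign_compatible (y v : 'rV[R]_n) : filippov X y v ->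
  sign_compatible (fun i => y 0 i) (fun i => v 0 i).
Proof.
move=> yv i; have a0 := a_gt0 i; split=> h.
- apply: (filippov_coord_le yv).
  apply: filterS (near_coordB (lt_nbhsl h)) => u ui.
  by rewrite X_parent pmulr_rle0//; exact: quantizer_le0.
- apply: (filippov_coord_ge yv).
  apply: filterS (near_coordB (lt_nbhsr h)) => u ui.
  by rewrite X_parent pmulr_rge0//; apply: quantizer_ge0 => //; exact: ltW.
- apply: (filippov_coord_ge yv).
  apply: filterS (near_coordB (lt_nbhsr h)) => u ui.
  by rewrite X_parent ler_pM2l//; apply: quantizer_geD => //; exact: ltW.
- apply: (filippov_coord_le yv).
  apply: filterS (near_coordB (lt_nbhsl h)) => u ui.
  by rewrite X_parent -mulrN ler_pM2l//; exact: quantizer_leD.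
Qed.

Variable x : R -> 'rV[R]_n.
Hypothesis x_sol : filippov_solution X x.

Lemma parent_gap_limsup (c : 'I_n -> R) d : (forall i, 0 < c i) -> 0 < d ->
  dissipative c d -> forall k eps, 0 < eps ->
  \forall t \near +oo, `|x t 0 (p k) - x t 0 k| - Delta / 2 < eps.
Proof.
move=> c0 d0 cd k.
pose z t i := x t 0 (p i) - x t 0 i.
pose V t := \sum_i (c i * a i) * quantizer_primitive Delta (z t i).
pose B := `|x 0|.
have B0 : 0 <= B by exact: normr_ge0.
(* [Phi] has Lipschitz constant [2 * B + Delta] on the gaps that occur, and a gap changes at most
   twice as fast as the state. *)
pose L := \sum_i (c i * a i) * ((2 * B + Delta) * 2).
have L0 : 0 <= L.
  apply: sumr_ge0 => i _; have := Delta_gt0 => ?.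
  rewrite mulr_ge0 ?(mulr_ge0 (ltW (c0 i)) (ltW (a_gt0 i)))//; lra.
have zB t i : 0 <= t -> `|z t i| <= 2 * B.
  move=> t0; apply: (le_trans (ler_normB _ _)).
  have := solution_bounded Delta_gt0 x_sol t0; rewrite -/B.
  have := coord_le_norm (x t) (p i); have := coord_le_norm (x t) i; lra.
have VL s t : 0 <= s -> s <= t -> `|V t - V s| <= L * enorm (x t - x s).
  move=> s0 st; rewrite -sumrB mulr_suml.
  apply: (le_trans (ler_norm_sum _ _ _)); apply: ler_sum => i _.
  have ca : 0 <= c i * a i by rewrite mulr_ge0 ?(ltW (c0 i)) ?(ltW (a_gt0 i)).
  rewrite -mulrBr normrM (ger0_norm ca) -mulrA ler_wpM2l//.
  apply: (le_trans (quantizer_primitive_lipschitz Delta_gt0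
    (zB s i s0) (zB t i (le_trans s0 st)))).
  rewrite -mulrA ler_wpM2l//; first by have := Delta_gt0; lra.
  have -> : z t i - z s i = (x t - x s) 0 (p i) - (x t - x s) 0 i.
    by rewrite /z !mxE; ring.
  apply: (le_trans (ler_normB _ _)).
  by rewrite mulr_natl mulr2n lerD//; exact: coord_le_enorm.
have Vdini t v : velocity G Delta x t v ->
    dini_le V t (\sum_i c i * (v 0 i * (v 0 (p i) - v 0 i))).
  move=> [xv Fv jv]; apply: dini_le_sum => i.
  have ca : 0 <= c i * a i by rewrite mulr_ge0 ?(ltW (c0 i)) ?(ltW (a_gt0 i)).
  (* At a jump both sides vanish because the gap is stationary; elsewhere
     [v 0 i = a i * q (z t i)]. *)
  have -> : c i * (v 0 i * (v 0 (p i) - v 0 i)) =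
      (c i * a i) * (q (z t i) * (v 0 (p i) - v 0 i)).
    have [/jv ->|nj] := pselect (quantizer_jump Delta (z t i)).
      by rewrite subrr !mulr0.
    by rewrite (filippov_parent Fv nj); rewrite /z; ring.
  apply: dini_leM => //; apply: quantizer_primitive_dini => //.
    exact: rderivB.
  by move=> /jv ->; rewrite subrr.
apply: (@descent_limsup_le0 _ V _ (2 * speed_bound G Delta B) d) => //.
- by rewrite mulr_ge0//; exact: speed_bound_ge0.
- move=> t; apply: sumr_ge0 => i _.
  by rewrite mulr_ge0 ?quantizer_primitive_ge0// mulr_ge0 ?ltW.
- move=> b b' b0 bb; rewrite -subr_le0 -[0](mul0r (b' - b)).
  apply: (solution_dini_le x_sol b0 bb L0) => [s t bs st _|t v bt _ tv].
    by apply: VL => //; exact: le_trans b0 bs.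
  apply: dini_leW (Vdini t v tv); have [_ Fv _] := tv.
  by have [] := cd _ _ (filippov_sign_compatible Fv).
- move=> b b' b0 bb zb.
  apply: (solution_dini_le x_sol b0 bb L0) => [s t bs st _|t v bt tb tv].
    by apply: VL => //; exact: le_trans b0 bs.
  apply: dini_leW (Vdini t v tv); have [_ Fv _] := tv.
  have [_] := cd _ _ (filippov_sign_compatible Fv); apply.
  by rewrite -subr_gt0; apply: zb => //; exact: ltW.
- by move=> s t s0 st; exact: solution_gap_lipschitz.
Qed.

End Descent.

Lemma weight_lower_bound (f : 'I_n -> R) : (forall i, 0 < f i) ->
  exists2 m : R, 0 < m & forall i, m <= f i.
Proof.
move=> f0; exists (\big[Num.min/1]_i f i); last by move=> i; exact: bigmin_le.
by apply: lt_bigmin.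
Qed.

(* On a cycle, [\sum_i v i * (v (p i) - v i)] is
   [- 1 / 2 * \sum_i (v (p i) - v i) ^+ 2].  The gaps sum to zero along each
   cycle, so a velocity [v k >= a k * Delta] is matched by some [v j <= 0] on
   the same cycle, and one of the jumps of [v] between [k] and [j] is large. *)
Lemma ring_dissipative : injective p ->
  exists2 d, 0 < d & dissipative (fun=> 1) d.
Proof.
move=> p_inj; have [m m0 ma] := weight_lower_bound a_gt0.
(* If all jumps of [v] were below [h], then starting from [v k >= (n + 1) * h], at most [n] steps
   along the cycle would keep [v] positive. *)
pose h := m * Delta / n.+1%:R.
have h0 : 0 < h by rewrite divr_gt0// mulr_gt0.
exists (h ^+ 2 / 2); first by rewrite divr_gt0// exprn_gt0.
have sumE (v : 'I_n -> R) : \sum_i 1 * (v i * (v (p i) - v i)) =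
    - (\sum_i (v (p i) - v i) ^+ 2) / 2.
  have E : \sum_i v (p i) ^+ 2 = \sum_i v i ^+ 2.
    by rewrite [RHS](reindex_inj p_inj).
  have -> : \sum_i (v (p i) - v i) ^+ 2 =
      \sum_i (v (p i) ^+ 2 - v i ^+ 2 - 2 * (v i * (v (p i) - v i))).
    by apply: eq_bigr => i _; ring.
  rewrite sumrB sumrB E subrr sub0r opprK -!mulr_sumr mul1r.
  by rewrite mulrAC mulfV// mul1r.
have key y v k : sign_compatible y v -> Delta / 2 < y (p k) - y k ->
    h ^+ 2 <= \sum_i (v (p i) - v i) ^+ 2.
  move=> yv yk; rewrite leNgt; apply/negP => small.
  have step i : v i - h < v (p i).
    have : `|v (p i) - v i| < h.
      rewrite -(@ltr_pXn2r _ 2)// ?nnegrE ?ltW// real_normK ?num_real//.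
      apply: le_lt_trans small; rewrite [leRHS](bigD1 i)//= lerDl.
      by apply: sumr_ge0 => j _; exact: sqr_ge0.
    rewrite ltr_norml; lra.
  have down l : v k - l%:R * h <= v (iter l p k).
    elim: l => [|l IH] /=; first by rewrite mul0r subr0.
    have := step (iter l p k); rewrite -natr1 mulrDl mul1r; lra.
  have vk : m * Delta <= v k.
    have [_ _ /(_ yk) H _] := yv k; apply: le_trans H.
    by rewrite ler_wpM2r// ltW.
  (* A positive velocity excludes a nonpositive gap, so [y] would increase strictly all the way
     around the cycle of [k] and back to [y k]. *)
  have up l : (l < order p k)%N -> 0 < y (p (iter l p k)) - y (iter l p k).
    move=> lo; rewrite ltNge; apply/negP => yl.
    have [H _ _ _] := yv (iter l p k).
    have : v (iter l p k) <= 0 by apply: H; have := Delta_gt0; lra.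
    have : l%:R * h <= n%:R * h.
      rewrite ler_wpM2r ?(ltW h0)// ler_nat (leq_trans (ltnW lo))//.
      by rewrite /order (leq_trans (max_card _))// card_ord.
    have : n.+1%:R * h = m * Delta by rewrite /h mulrC divfK.
    rewrite -natr1 mulrDl mul1r; have := down l; lra.
  have incr l : (l < order p k)%N -> y k < y (iter l.+1 p k).
    elim: l => [|l IH] lo; have := up _ lo; rewrite subr_gt0//=.
    by apply: lt_trans; exact: IH (ltnW lo).
  have := incr (order p k).-1; have o0 := order_gt0 p k.
  by rewrite prednK// iter_order// ltxx => /(_ (leqnn _)).
move=> y v yv; split=> [|k].
  rewrite sumE mulNr oppr_le0 divr_ge0//.
  by apply: sumr_ge0 => i _; exact: sqr_ge0.
rewrite ltr_normr => yk; rewrite sumE mulNr lerN2 ler_pM2r//.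
case/orP: yk => yk; first exact: key yv yk.
have := key _ _ k (sign_compatibleN yv); rewrite -opprD.
have -> : \sum_i (- v (p i) - - v i) ^+ 2 = \sum_i (v (p i) - v i) ^+ 2.
  by apply: eq_bigr => i _; rewrite -opprD sqrrN.
by apply.
Qed.

(* Weights decreasing geometrically with the depth let each node absorb the
   velocities of all its children. *)
Lemma tree_dissipative (r : 'I_n) : p r = r ->
  (forall i, exists m, iter m p i = r) ->
  exists c d, [/\ forall i, 0 < c i, 0 < d & dissipative c d].
Proof.
move=> pr reach.
have reachb i : exists m, iter m p i == r by have [m /eqP] := reach i; exists m.
pose depth i := ex_minn (reachb i).
have n0 : 0 < n%:R :> R by rewrite ltr0n; case: n r {pr reach reachb depth} => // -[].
have n2 : 0 < 2 * n%:R :> R by rewrite mulr_gt0.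
have n21 : 1 <= 2 * n%:R :> R.
  by rewrite -natrM ler1n muln_gt0/= -(ltr0n R).
pose c i : R := (2 * n%:R) ^- depth i.
have c0 i : 0 < c i by rewrite invr_gt0 exprn_gt0.
have cp i : i != r -> c i * (2 * n%:R) <= c (p i).
  move=> ir; rewrite /c /depth.
  case: ex_minnP => -[|l] /eqP /= li _.
    by rewrite li eqxx in ir.
  case: ex_minnP => l' _ /(_ l) H.
  have l'l : (l' <= l)%N by apply: H; rewrite -iterSr /= li.
  rewrite exprS invfM mulrAC mulVf ?gt_eqF// mul1r.
  by rewrite lef_pV2 ?posrE ?exprn_gt0// ler_weXn2l.
have [m m0 ma] := weight_lower_bound a_gt0.
have [m' m'0 mc] := weight_lower_bound c0.
(* The sum is at most [- S / 4], and a large gap at [k] gives [S >= c k * v k ^+ 2 >= m' * (m *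
   Delta) ^+ 2]. *)
pose d := m' * (m * Delta) ^+ 2 / 4.
have mD : 0 < m * Delta by rewrite mulr_gt0.
exists c, d; split=> //; first by rewrite divr_gt0// mulr_gt0// exprn_gt0.
move=> y v yv.
pose S := \sum_i c i * v i ^+ 2.
have cv i : 0 <= c i * v i ^+ 2 by rewrite mulr_ge0 ?sqr_ge0// ltW.
have S0 : 0 <= S by apply: sumr_ge0.
have Sge i : c i * v i ^+ 2 <= S.
  by rewrite /S (bigD1 i)//= lerDl; apply: sumr_ge0.
have vr : v r = 0.
  have [h1 h2 _ _] := yv r; rewrite pr subrr in h1 h2.
  have D2 : 0 < Delta / 2 by rewrite divr_gt0.
  by apply/eqP; rewrite eq_le h1// h2// mulNr oppr_lt0.
(* Young's inequality keeps half of [- c i * v i ^+ 2] and leaves [c i * v (p i) ^+ 2 / 2]. The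
   ratio [2 * n] of the weights makes this at most [S / (4 * n)], so the [n] errors add up to half
   of the gain [S / 2]. *)
have term i : c i * (v i * (v (p i) - v i)) <=
    - (c i * v i ^+ 2) / 2 + S / (4 * n%:R).
  have [->|ir] := eqVneq i r.
    by rewrite vr !(mul0r, mulr0) expr0n/= mulr0 oppr0 mul0r add0r divr_ge0// mulr_ge0 ?ltW.
  have h : c i * v (p i) ^+ 2 <= S / (2 * n%:R).
    rewrite ler_pdivlMr//; apply: le_trans (Sge (p i)).
    by rewrite mulrAC ler_wpM2r ?sqr_ge0// cp.
  have -> : S / (4 * n%:R) = S / (2 * n%:R) / 2.
    by field; rewrite gt_eqF.
  have : 0 <= c i * (v i - v (p i)) ^+ 2 by rewrite mulr_ge0 ?sqr_ge0// ltW.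
  move: h; nra.
have total : \sum_i c i * (v i * (v (p i) - v i)) <= - S / 4.
  apply: (le_trans (ler_sum _ (fun i _ => term i))).
  rewrite big_split/= sumr_const card_ord -mulr_suml sumrN -/S.
  rewrite -[_ *+ n]mulr_natl.
  have -> : n%:R * (S / (4 * n%:R)) = S / 4 by field; rewrite gt_eqF.
  lra.
split=> [|k]; first by apply: (le_trans total); lra.
rewrite ltr_normr => yk; apply: (le_trans total); rewrite mulNr lerN2 ler_pM2r//.
apply: le_trans (Sge k); apply: ler_pM; rewrite ?sqr_ge0 ?(ltW m'0)//.
have mDv : m * Delta <= `|v k|.
  have aD : m * Delta <= a k * Delta by rewrite ler_wpM2r// ltW.
  have [_ _ h3 h4] := yv k; rewrite ler_normr; case/orP: yk => yk.
    by rewrite (le_trans aD (h3 yk)).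
  apply/orP; right; rewrite lerNr; apply: (@le_trans _ _ (- (a k * Delta))).
    by apply: h4; lra.
  by rewrite lerN2.
by rewrite -[leRHS]real_normK ?num_real// lerXn2r ?nnegrE ?(ltW mD).
Qed.

End ParentField.

(** * Undirected graphs *)

Section UndirectedField.
Set Implicit Arguments.
Unset Strict Implicit.
Unset Printing Implicit Defensive.
Context {R : realType} {n : nat}.
Variables (G : wdigraph R n) (Delta : R).
Hypothesis Delta_gt0 : 0 < Delta.
Hypothesis G_sym : undirected G.
Local Notation X := (quantized_field G Delta).
Local Notation q := (quantizer Delta).
Implicit Types (i j : 'I_n).

(** The factor [z] is the gap at the centre and [q z'] the interaction at a nearby point. They
    cannot have opposite signs, since [q] changes sign only at distance [Delta / 2] from [0]. *)
Lemma near_mul_quantizer_ge0 (z : R) : \forall z' \near z, 0 <= z * q z'.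
Proof.
have D2 : 0 < Delta / 2 by rewrite divr_gt0.
have [z0|z0|->] := ltrgtP z 0; last by near=> z'; rewrite mul0r.
  have : z < Delta / 2 by exact: lt_trans D2.
  move=> /lt_nbhsl; apply: filterS => z' zD.
  by rewrite mulr_le0 ?(ltW z0)//; exact: quantizer_le0.
have : - Delta / 2 < z by lra.
move=> /lt_nbhsr; apply: filterS => z' zD.
by rewrite mulr_ge0 ?(ltW z0)//; apply: quantizer_ge0 => //; exact: ltW.
Unshelve. all: by end_near. Qed.

Lemma near_mul_quantizer_ge (z : R) : Delta / 2 < `|z| ->
  \forall z' \near z, Delta ^+ 2 / 2 <= z * q z'.
Proof.
have D0 := Delta_gt0.
rewrite ltr_normr => /orP[z0|z0].
  apply: filterS (lt_nbhsr z0) => z' zD.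
  by have := quantizer_geD Delta_gt0 (ltW zD); nra.
have : z < - Delta / 2 by lra.
move=> /lt_nbhsl; apply: filterS => z' zD.
by have := quantizer_leD Delta_gt0 zD; nra.
Qed.

Lemma near_pairs_coordB (y : 'rV[R]_n) (P : 'I_n -> 'I_n -> R -> Prop) :
  (forall i j, \forall z \near (y 0 j - y 0 i), P i j z) ->
  \forall u \near y, forall ij : 'I_n * 'I_n,
    P ij.1 ij.2 ((u : 'rV[R]_n) 0 ij.2 - u 0 ij.1).
Proof.
move=> yP; apply: (@filter_forall _ _
  (fun (ij : 'I_n * 'I_n) (u : 'rV[R]_n) => P ij.1 ij.2 (u 0 ij.2 - u 0 ij.1))
  (nbhs y) _) => -[i j].
exact: near_coordB.
Qed.

(* Outside the null set of diagonals the interactions [q (u j - u i)] and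
   [q (u i - u j)] are opposite, so that the sum can be symmetrized. *)
Lemma filippov_undirected_le (y v : 'rV[R]_n) (d : 'I_n -> 'I_n -> R) :
  filippov X y v ->
  (forall i j, \forall z' \near (y 0 j - y 0 i),
     d i j <= (y 0 j - y 0 i) * q z') ->
  \sum_i 2 * (y 0 i * v 0 i) <= - \sum_i \sum_j adj G i j * d i j.
Proof.
move=> yv yd.
under eq_bigr do rewrite mulrA.
apply: (filippov_le (lebesgue_null_diagonals y) _ yv).
have near1 : \forall u \near y, forall l, `|(u : 'rV[R]_n) 0 l - y 0 l| < 2^-1.
  apply/nbhs_normP; exists 2^-1 => //= u uy l.
  apply: le_lt_trans uy; rewrite distrC.
  by have := coord_le_norm (y - u) l; rewrite !mxE.
have near2 := near_pairs_coordB yd.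
have near3 := @near_pairs_coordB y
  (fun i j z => z != y 0 j - y 0 i -> ~ quantizer_jump Delta z)
  (fun i j => quantizer_jump_isolated Delta_gt0 _).
apply: filterS3 near1 near2 near3 => u u1 u2 u3 uS.
pose T i j := adj G i j * q (u 0 j - u 0 i).
have T_anti i j : T j i = - T i j.
  have [->|ij] := eqVneq i j; first by rewrite /T adj_diag !mul0r oppr0.
  (* Off the diagonals the gap differs from its value at [y], and near that value there is no other
     jump. *)
  have nj : ~ quantizer_jump Delta (u 0 j - u 0 i).
    apply: (u3 (i, j)); apply/eqP => uE; apply: uS; split=> //.
    by exists i, j.
  have A_sym : adj G j i = adj G i j by rewrite {1}G_sym mxE.
  by rewrite /T A_sym -mulrN -quantizerN// opprB.
have -> : \sum_i 2 * y 0 i * X u 0 i = \sum_i \sum_j 2 * (y 0 i * T i j).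
  by apply: eq_bigr => i _; rewrite mxE mulr_sumr; apply: eq_bigr => j _; rewrite /T; ring.
have -> : \sum_i \sum_j 2 * (y 0 i * T i j) =
    - \sum_i \sum_j adj G i j * ((y 0 j - y 0 i) * q (u 0 j - u 0 i)).
  have -> : \sum_i \sum_j 2 * (y 0 i * T i j) =
      \sum_i \sum_j y 0 i * T i j + \sum_i \sum_j y 0 j * T j i.
    rewrite [X in _ = _ + X]exchange_big/= -big_split/=; apply: eq_bigr => i _.
    by rewrite -big_split/=; apply: eq_bigr => j _; rewrite mulr_natl mulr2n.
  rewrite -big_split/= -sumrN; apply: eq_bigr => i _.
  rewrite -big_split/= -sumrN; apply: eq_bigr => j _.
  by rewrite (T_anti i j) /T; ring.
rewrite lerN2; apply: ler_sum => i _; apply: ler_sum => j _.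
by rewrite ler_wpM2l ?adj_ge0//; exact: (u2 (i, j)).
Qed.

Variable x : R -> 'rV[R]_n.
Hypothesis x_sol : filippov_solution X x.

Lemma undirected_gap_limsup i j : edge G i j -> forall eps, 0 < eps ->
  \forall t \near +oo, `|x t 0 i - x t 0 j| - Delta / 2 < eps.
Proof.
move=> ij; have w0 : 0 < adj G j i by rewrite adj_gt0.
pose d := adj G j i * (Delta ^+ 2 / 2).
have d0 : 0 < d by rewrite mulr_gt0// divr_gt0// exprn_gt0.
pose V t := \sum_k x t 0 k ^+ 2.
pose B := `|x 0|.
have B0 : 0 <= B by exact: normr_ge0.
pose L := \sum_(k < n) (2 * B).
have L0 : 0 <= L by apply: sumr_ge0 => k _; rewrite mulr_ge0.
have VL s t : 0 <= s -> s <= t -> `|V t - V s| <= L * enorm (x t - x s).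
  move=> s0 st; rewrite -sumrB mulr_suml.
  apply: (le_trans (ler_norm_sum _ _ _)); apply: ler_sum => k _.
  rewrite subr_sqr mulrC normrM; apply: ler_pM => //.
    apply: (le_trans (ler_normD _ _)).
    have := solution_bounded Delta_gt0 x_sol s0.
    have := solution_bounded Delta_gt0 x_sol (le_trans s0 st).
    have := coord_le_norm (x t) k; have := coord_le_norm (x s) k.
    rewrite -/B; lra.
  by have := coord_le_enorm (x t - x s) k; rewrite !mxE.
have Vdini t v : velocity G Delta x t v ->
    dini_le V t (\sum_k 2 * (x t 0 k * v 0 k)).
  move=> [xv _ _]; apply: dini_le_sum => k.
  exact/rderiv_dini/rderiv_sqr.
apply: (@descent_limsup_le0 _ V _ (2 * speed_bound G Delta B) d) => //.
- by rewrite mulr_ge0//; exact: speed_bound_ge0.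
- by move=> t; apply: sumr_ge0 => k _; exact: sqr_ge0.
- move=> b b' b0 bb; rewrite -subr_le0 -[0](mul0r (b' - b)).
  apply: (solution_dini_le x_sol b0 bb L0) => [s t bs st _|t v bt _ tv].
    by apply: VL => //; exact: le_trans b0 bs.
  apply: dini_leW (Vdini t v tv); have [_ Fv _] := tv.
  have := @filippov_undirected_le _ _ (fun _ _ => 0) Fv
    (fun _ _ => near_mul_quantizer_ge0 _).
  rewrite [X in - X]big1 ?oppr0// => k _.
  by rewrite big1// => l _; rewrite mulr0.
- move=> b b' b0 bb zb.
  apply: (solution_dini_le x_sol b0 bb L0) => [s t bs st _|t v bt tb tv].
    by apply: VL => //; exact: le_trans b0 bs.
  apply: dini_leW (Vdini t v tv); have [_ Fv _] := tv.
  have gap : Delta / 2 < `|x t 0 i - x t 0 j|.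
    by rewrite -subr_gt0; apply: zb => //; exact: ltW.
  (* The pair [(j, i)], whose weight is positive as [(i, j)] is an edge, provides the rate [d]
     alone; the other terms are bounded below by [0]. *)
  pose D k l := if (k == j) && (l == i) then Delta ^+ 2 / 2 else 0.
  apply: (le_trans (@filippov_undirected_le _ _ D Fv _)).
    move=> k l; rewrite /D; case: ifPn => [/andP[/eqP-> /eqP->]|_].
      exact: near_mul_quantizer_ge.
    exact: near_mul_quantizer_ge0.
  rewrite lerN2 (bigD1 j)//= (bigD1 i)//= /D !eqxx/= big1 ?addr0.
    rewrite big1 ?addr0// => k /negbTE kj.
    by rewrite big1// => l _; rewrite kj/= mulr0.
  by move=> l /negbTE->; rewrite mulr0.
- by move=> s t s0 st; exact: solution_gap_lipschitz.
Qed.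

End UndirectedField.

(** * Graphs in which every node has at most one incoming edge *)

Section ParentMap.
Set Implicit Arguments.
Unset Strict Implicit.
Unset Printing Implicit Defensive.
Context {R : realType} {n : nat}.
Variables (G : wdigraph R n) (Delta : R).
Hypothesis Delta_gt0 : 0 < Delta.
Hypothesis parent_uniq : forall i j k, edge G j i -> edge G k i -> j = k.

(* Orphans are their own parents: their gap and hence their velocity vanish,
   whatever the positive weight attached to them. *)
Definition parent i := if [pick j | edge G j i] is Some j then j else i.

Definition parent_weight i :=
  if [pick j | edge G j i] is Some j then adj G i j else 1.

Lemma parentP i j : edge G j i -> parent i = j.
Proof.
rewrite /parent; case: pickP => [k ki ji|-> //]; exact: parent_uniq ki ji.
Qed.

Lemma parent_weight_gt0 i : 0 < parent_weight i.
Proof. by rewrite /parent_weight; case: pickP => // j; rewrite -adj_gt0. Qed.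

Lemma quantized_field_parent y i : quantized_field G Delta y 0 i =
  parent_weight i * quantizer Delta (y 0 (parent i) - y 0 i).
Proof.
have adj0 j : ~~ edge G j i -> adj G i j = 0.
  by rewrite -adj_gt0 -leNgt => h; apply/eqP; rewrite eq_le h adj_ge0.
rewrite mxE /parent_weight /parent; case: pickP => [k ki|none].
  rewrite (bigD1 k)//= big1 ?addr0// => j jk.
  rewrite adj0 ?mul0r//; apply: contraNN jk => ji; apply/eqP.
  exact: parent_uniq ji ki.
rewrite subrr quantizer0// mulr0 big1// => j _.
by rewrite adj0 ?mul0r// none.
Qed.

End ParentMap.

(** * The three classes of graphs *)

Section GraphCases.
Set Implicit Arguments.
Unset Strict Implicit.
Unset Printing Implicit Defensive.
Context {R : realType} {n : nat}.
Variable G : wdigraph R n.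

Lemma pred_card1_uniq (P : pred 'I_n) (i j : 'I_n) :
  #|[pred k | P k]| = 1%N -> P i -> P j -> i = j.
Proof.
move=> P1 Pi Pj; have /card_le1_eqP H : (#|[pred k | P k]| <= 1)%N by rewrite P1.
exact: H.
Qed.

Lemma directed_ring_parent_uniq : directed_ring G ->
  forall i j k, edge G j i -> edge G k i -> j = k.
Proof.
by move=> ring i j k; apply: (@pred_card1_uniq (edge G ^~ i)); have [] := ring i.
Qed.

Lemma directed_ring_parent_inj : directed_ring G -> injective (parent G).
Proof.
move=> ring.
have parent_edge i : edge G (parent G i) i.
  have [_ /eqP/card1P[j jE]] := ring i.
  have ji : edge G j i by have := jE j; rewrite !inE eqxx.
  by rewrite (parentP (directed_ring_parent_uniq ring) ji).
move=> i j ij; have [out _] := ring (parent G i).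
apply: (@pred_card1_uniq (edge G (parent G i)) _ _ out (parent_edge i)).
by have := parent_edge j; rewrite -ij.
Qed.

Lemma directed_spanning_tree_parent_uniq : directed_spanning_tree G ->
  forall i j k, edge G j i -> edge G k i -> j = k.
Proof.
move=> [r [r_in uniq_in _]] i j k ji ki.
have ir : i != r by apply: contraTneq ji => ->; exact: r_in.
exact: (@pred_card1_uniq (edge G ^~ i) _ _ (uniq_in i ir) ji ki).
Qed.

(** A path from the root to [i], read backwards, is the orbit of [i] under [parent]; hence the
    induction from the last node of the path. *)
Lemma directed_spanning_tree_root : directed_spanning_tree G ->
  exists r, parent G r = r /\ forall i, exists m, iter m (parent G) i = r.
Proof.
move=> tree; have uniq := directed_spanning_tree_parent_uniq tree.
have [r [r_in _ reach]] := tree; exists r; split.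
  by rewrite /parent; case: pickP => // j jr; have := r_in j; rewrite jr.
move=> i; have [->|ir] := eqVneq i r; first by exists 0%N.
have /connectP[s rs ->] := reach i ir; exists (size s).
elim/last_ind: s rs => // s j IH; rewrite rcons_path => /andP[rs sj].
by rewrite last_rcons size_rcons iterSr (parentP uniq sj) IH.
Qed.

End GraphCases.

Theorem theoremV3 (R : realType) (n : nat) (G : wdigraph R n) (Delta : R)
    (Delta_gt0 : 0 < Delta)
    (graph_cases :
       undirected G \/ (directed_ring G \/ directed_spanning_tree G))
    (x : R -> 'rV[R]_n)
    (x_sol : filippov_solution (quantized_field G Delta) x) :
  dist_to (x t) (H1 G Delta) @[t --> +oo] --> (0 : R).
Proof.
apply: cvg_dist_to_H1 (Delta_gt0) (solution_bounded Delta_gt0 x_sol) _.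
move=> i j ij eps eps0.
have [und|cases] := graph_cases.
  exact: (undirected_gap_limsup Delta_gt0 und x_sol ij eps0).
have uniq : forall k l m, edge G l k -> edge G m k -> l = m.
  case: cases; first exact: directed_ring_parent_uniq.
  exact: directed_spanning_tree_parent_uniq.
have wgt := parent_weight_gt0 G.
have [c [d [c0 d0 cd]]] : exists c d, [/\ forall k, 0 < c k, 0 < d &
    dissipative Delta (parent G) (parent_weight G) c d].
  case: cases => [/directed_ring_parent_inj inj|/directed_spanning_tree_root[r [pr reach]]].
    have [d d0 cd] := ring_dissipative Delta_gt0 wgt inj.
    by exists (fun=> 1), d; split.
  exact: (tree_dissipative Delta_gt0 wgt pr reach).
have := parent_gap_limsup Delta_gt0 wgt
  (quantized_field_parent Delta_gt0 uniq) x_sol c0 d0 cd j eps0.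
by rewrite (parentP uniq ij).
Qed.
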